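(* Let $U\subset\mathbb{R}^n$ be a bounded domain with smooth boundary and let $(u_1,u_2)\in C(\overline U)^2$. Then $(u_1,u_2)$ is a viscosity subsolution of the system (S) in $U$ if and only if $(u_1,u_2)$ enjoys comparison with generalized cones from above in $U$. Likewise, $(u_1,u_2)$ is a viscosity supersolution of (S) in $U$ if and only if it enjoys comparison with generalized cones from below in $U$.
   Context: For $\varphi\in C^2$ near $x$, set $\Delta_\infty\varphi(x)=|D\varphi(x)|^{-2}\sum_{k,l=1}^n\varphi_{x_k}\varphi_{x_l}\varphi_{x_kx_l}(x)$ when $D\varphi(x)\neq0$. Define $\Delta_\infty^+\varphi(x)=\Delta_\infty\varphi(x)$ if $D\varphi(x)\ne0$ and $\Delta_\infty^+\varphi(x)=\max\{D^2\varphi(x)v\cdot v: v\in\mathbb{S}^{n-1}\}$ if $D\varphi(x)=0$; define $\Delta_\infty^-\varphi(x)$ in the same way with $\min$ in place of $\max$. The system (S) on an open set $\Omega$ is: $-\Delta_\infty u_1+u_1-u_2=0$ and $-\Delta_\infty u_2+u_2-u_1=0$ in $\Omega$. A pair $(u_1,u_2)$ of upper semicontinuous functions on $\Omega$ is a viscosity subsolution of (S) in $\Omega$ if for each $i\in\{1,2\}$, $j=3-i$, and each $\varphi\in C^2(\Omega)$ such that $u_i-\varphi$ has a local maximum at $x_0\in\Omega$, one has $-\Delta_\infty^+\varphi(x_0)+u_i(x_0)-u_j(x_0)\le0$. A pair of lower semicontinuous functions on $\Omega$ is a viscosity supersolution if for each $i$, $j=3-i$, and each $\varphi\in C^2(\Omega)$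 such that $u_i-\varphi$ has a local minimum at $x_0\in\Omega$, one has $-\Delta_\infty^-\varphi(x_0)+u_i(x_0)-u_j(x_0)\ge0$. A viscosity solution is a pair that is both a subsolution and a supersolution. Generalized cones: for $x_0\in\mathbb{R}^n$ and $C_1,C_2,a,b\in\mathbb{R}$, $\psi_1(x)=C_1e^{\sqrt2|x-x_0|}+C_2e^{-\sqrt2|x-x_0|}+a|x-x_0|+b$ and $\psi_2(x)=-C_1e^{\sqrt2|x-x_0|}-C_2e^{-\sqrt2|x-x_0|}+a|x-x_0|+b$. A pair $(u_1,u_2)\in C(\overline U)^2$ enjoys comparison with generalized cones from above in $U$ if for every $x_0\in U$, every $r>0$ with $\overline B(x_0,r)\subset U$ and every $C_1,C_2,a,b\in\mathbb{R}$, with $(\psi_1,\psi_2)$ the generalized cones centered at $x_0$ with these parameters: if $u_i\le\psi_i$ on $\partial B(x_0,r)\cup\{x_0\}$ for $i=1,2$, then $u_i\le\psi_i$ on $\overline B(x_0,r)$ for $i=1,2$. Comparison from below is defined identically with all inequalities $\le$ replaced by $\ge$. *)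

(* Defs.v *)
From Stdlib Require Import Reals.
From mathcomp Require Import all_boot.
Set Implicit Arguments.
Unset Strict Implicit.
Open Scope R_scope.

Definition vec (n : nat) := 'I_n -> R.
Definition vset (n : nat) := vec n -> Prop.

Definition vzero (n : nat) : vec n := fun _ => 0.
Arguments vzero n _ : clear implicits.
Definition vadd {n} (x y : vec n) : vec n := fun i => x i + y i.
Definition vsub {n} (x y : vec n) : vec n := fun i => x i - y i.
Definition vscal {n} (t : R) (x : vec n) : vec n := fun i => t * x i.
Definition ebasis {n} (i : 'I_n) : vec n := fun j => if j == i then 1 else 0.
Definition vdot {n} (x y : vec n) : R := \big[Rplus/0]_(i < n) (x i * y i).
Definition vnorm {n} (x : vec n) : R := sqrt (vdot x x).
Definition vdist {n} (x y : vec n) : R := vnorm (vsub x y).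
Definition ball {n} (p : vec n) (r : R) : vset n := fun x => vdist x p < r.

Definition vopen {n} (O : vset n) : Prop :=
  forall x, O x -> exists r, 0 < r /\ forall y, vdist y x < r -> O y.
Definition vclosure {n} (U : vset n) : vset n :=
  fun x => forall r, 0 < r -> exists y, U y /\ vdist y x < r.
Definition vboundary {n} (U : vset n) : vset n := fun x => vclosure U x /\ ~ U x.
Definition vbounded {n} (U : vset n) : Prop :=
  exists M, forall x, U x -> vnorm x <= M.
Definition vconnected {n} (U : vset n) : Prop :=
  forall A B : vset n, vopen A -> vopen B ->
    (forall x, U x -> A x \/ B x) -> (forall x, U x -> A x -> B x -> False) ->
    (forall x, U x -> ~ A x) \/ (forall x, U x -> ~ B x).
Definition vdomain {n} (U : vset n) : Prop :=
  vopen U /\ (exists x, U x) /\ vconnected U.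

Definition cont_on {n} (O : vset n) (f : vec n -> R) : Prop :=
  forall x, O x -> forall eps, 0 < eps -> exists d, 0 < d /\
    forall y, O y -> vdist y x < d -> Rabs (f y - f x) < eps.
Definition usc_on {n} (O : vset n) (f : vec n -> R) : Prop :=
  forall x, O x -> forall eps, 0 < eps -> exists d, 0 < d /\
    forall y, O y -> vdist y x < d -> f y < f x + eps.
Definition lsc_on {n} (O : vset n) (f : vec n -> R) : Prop :=
  forall x, O x -> forall eps, 0 < eps -> exists d, 0 < d /\
    forall y, O y -> vdist y x < d -> f x - eps < f y.

Definition has_partial {n} (f : vec n -> R) (i : 'I_n) (x : vec n) (l : R) : Prop :=
  derivable_pt_lim (fun t => f (vadd x (vscal t (ebasis i)))) 0 l.

Fixpoint Ck {n} (k : nat) (O : vset n) (f : vec n -> R) : Prop :=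
  match k with
  | 0 => cont_on O f
  | k'.+1 => cont_on O f /\
      forall i : 'I_n, exists g : vec n -> R,
        (forall x, O x -> has_partial f i x (g x)) /\ Ck k' O g
  end.
Definition Cinf {n} (O : vset n) (f : vec n -> R) : Prop := forall k, Ck k O f.

Definition smooth_boundary {n} (U : vset n) : Prop :=
  forall p, vboundary U p ->
    exists (r : R) (rho : vec n -> R) (Drho : vec n -> vec n),
      0 < r /\ Cinf (ball p r) rho /\
      (forall x, ball p r x -> forall i, has_partial rho i x (Drho x i)) /\
      (forall x, ball p r x -> Drho x <> vzero n) /\
      (forall x, ball p r x -> (U x <-> rho x < 0)).

Definition C2_with {n} (O : vset n) (phi : vec n -> R) (Dphi : vec n -> vec n)
    (D2phi : vec n -> 'I_n -> 'I_n -> R) : Prop :=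
  (forall x, O x -> forall k, has_partial phi k x (Dphi x k)) /\
  (forall x, O x -> forall k l, has_partial (fun y => Dphi y k) l x (D2phi x k l)) /\
  (forall k l, cont_on O (fun y => D2phi y k l)).

Definition quad {n} (H : 'I_n -> 'I_n -> R) (v : vec n) : R :=
  \big[Rplus/0]_(k < n) \big[Rplus/0]_(l < n) (H k l * v k * v l).

(* infinity Laplacian for nonzero gradient p and Hessian H *)
Definition inflap {n} (p : vec n) (H : 'I_n -> 'I_n -> R) : R :=
  / (vnorm p ^ 2) *
  \big[Rplus/0]_(k < n) \big[Rplus/0]_(l < n) (p k * p l * H k l).

(* "L = Delta_infty^+ phi(x0)" where p = Dphi x0, H = D2phi x0 *)
Definition inflap_plus_is {n} (p : vec n) (H : 'I_n -> 'I_n -> R) (L : R) : Prop :=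
  (p <> vzero n /\ L = inflap p H) \/
  (p = vzero n /\ (exists v, vnorm v = 1 /\ quad H v = L) /\
     (forall v, vnorm v = 1 -> quad H v <= L)).
Definition inflap_minus_is {n} (p : vec n) (H : 'I_n -> 'I_n -> R) (L : R) : Prop :=
  (p <> vzero n /\ L = inflap p H) \/
  (p = vzero n /\ (exists v, vnorm v = 1 /\ quad H v = L) /\
     (forall v, vnorm v = 1 -> L <= quad H v)).

Definition loc_max_at {n} (O : vset n) (f : vec n -> R) (x0 : vec n) : Prop :=
  exists r, 0 < r /\ forall y, O y -> vdist y x0 < r -> f y <= f x0.
Definition loc_min_at {n} (O : vset n) (f : vec n -> R) (x0 : vec n) : Prop :=
  exists r, 0 < r /\ forall y, O y -> vdist y x0 < r -> f x0 <= f y.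

Definition sub_test {n} (O : vset n) (ui uj : vec n -> R) : Prop :=
  forall phi Dphi D2phi x0, C2_with O phi Dphi D2phi -> O x0 ->
    loc_max_at O (fun x => ui x - phi x) x0 ->
    forall L, inflap_plus_is (Dphi x0) (D2phi x0) L ->
      - L + ui x0 - uj x0 <= 0.
Definition super_test {n} (O : vset n) (ui uj : vec n -> R) : Prop :=
  forall phi Dphi D2phi x0, C2_with O phi Dphi D2phi -> O x0 ->
    loc_min_at O (fun x => ui x - phi x) x0 ->
    forall L, inflap_minus_is (Dphi x0) (D2phi x0) L ->
      - L + ui x0 - uj x0 >= 0.

Definition visc_sub {n} (O : vset n) (u1 u2 : vec n -> R) : Prop :=
  usc_on O u1 /\ usc_on O u2 /\ sub_test O u1 u2 /\ sub_test O u2 u1.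
Definition visc_super {n} (O : vset n) (u1 u2 : vec n -> R) : Prop :=
  lsc_on O u1 /\ lsc_on O u2 /\ super_test O u1 u2 /\ super_test O u2 u1.

Definition psi1 {n} (x0 : vec n) (C1 C2 a b : R) (x : vec n) : R :=
  C1 * exp (sqrt 2 * vdist x x0) + C2 * exp (- (sqrt 2 * vdist x x0))
  + a * vdist x x0 + b.
Definition psi2 {n} (x0 : vec n) (C1 C2 a b : R) (x : vec n) : R :=
  - (C1 * exp (sqrt 2 * vdist x x0)) - C2 * exp (- (sqrt 2 * vdist x x0))
  + a * vdist x x0 + b.

Definition cone_cmp_above {n} (U : vset n) (u1 u2 : vec n -> R) : Prop :=
  forall x0 r C1 C2 a b, U x0 -> 0 < r ->
    (forall x, vdist x x0 <= r -> U x) ->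
    (forall x, (vdist x x0 = r \/ x = x0) ->
        u1 x <= psi1 x0 C1 C2 a b x /\ u2 x <= psi2 x0 C1 C2 a b x) ->
    forall x, vdist x x0 <= r ->
        u1 x <= psi1 x0 C1 C2 a b x /\ u2 x <= psi2 x0 C1 C2 a b x.
Definition cone_cmp_below {n} (U : vset n) (u1 u2 : vec n -> R) : Prop :=
  forall x0 r C1 C2 a b, U x0 -> 0 < r ->
    (forall x, vdist x x0 <= r -> U x) ->
    (forall x, (vdist x x0 = r \/ x = x0) ->
        u1 x >= psi1 x0 C1 C2 a b x /\ u2 x >= psi2 x0 C1 C2 a b x) ->
    forall x, vdist x x0 <= r ->
        u1 x >= psi1 x0 C1 C2 a b x /\ u2 x >= psi2 x0 C1 C2 a b x.

(* Main.v *)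
Require Import Defs.
From Stdlib Require Import Reals.
From mathcomp Require Import all_boot.
From HB Require Import structures.
From Stdlib Require Import Lra FunctionalExtensionality Classical ClassicalEpsilon.
From Coquelicot Require Import Coquelicot.
Open Scope R_scope.

(** Subsolutions compare with cones: adding [eps (r^2 - t^2)] to both radial
profiles makes them strict supersolutions of the ODE system, and one maximizes
[u_i(x) - k_i(|x - x0| + t)] over [i], [x] in the ball and small shifts [t].
The shift is what excludes the degenerate points where [k_i' = 0] and
[k_i'' < 0], at which [Delta_infty^+] does not see [k_i'']: such a point is a
strict local maximum of [k_i], hence not optimal in [t]. Everywhere else the
subsolution test contradicts strictness.

Conversely, if [phi] touches [u_1] from above at [x] and violates the test, one
compares with a cone centred at a point [y] at distance [sg r] from [x], with
[C1 = C2 = D'/4] where [Delta_infty^+ phi(x) < D' < u_1(x) - u_2(x)]; its first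
profile is [D' t^2 / 2 + a t + b + O(t^3)]. If [Dphi(x) <> 0] take [y] in the
direction [-Dphi(x)] and [sg = 1/2]; if [Dphi(x) = 0] any direction works with
[sg] small. Letting [r -> 0] contradicts the second-order expansion of [phi].

The statement for supersolutions follows by the change of sign [u -> -u]. *)

(** * Sums and Euclidean vectors *)

Lemma RplusAs : associative Rplus. Proof. by move=> x y z; ring. Qed.
Lemma RplusCm : commutative Rplus. Proof. by move=> x y; ring. Qed.
Lemma Rplus0l : left_id 0 Rplus. Proof. by move=> x; ring. Qed.
Lemma Rmult0l : left_zero 0 Rmult. Proof. by move=> x; ring. Qed.
Lemma Rmult0r : right_zero 0 Rmult. Proof. by move=> x; ring. Qed.
Lemma RmultDl : left_distributive Rmult Rplus. Proof. by move=> x y z; ring. Qed.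
Lemma RmultDr : right_distributive Rmult Rplus. Proof. by move=> x y z; ring. Qed.
HB.instance Definition _ := Monoid.isComLaw.Build R 0 Rplus RplusAs RplusCm Rplus0l.
HB.instance Definition _ := Monoid.isMulLaw.Build R 0 Rmult Rmult0l Rmult0r.
HB.instance Definition _ := Monoid.isAddLaw.Build R Rmult Rplus RmultDl RmultDr.

Notation "\rsum_ ( i < n ) F" := (\big[Rplus/0]_(i < n) F)
  (at level 41, i, n at level 50, F at level 41).

Lemma rsumD n (F G : 'I_n -> R) :
  \rsum_(i < n) (F i + G i) = \rsum_(i < n) F i + \rsum_(i < n) G i.
Proof. exact: big_split. Qed.

Lemma rsumZ n c (F : 'I_n -> R) : \rsum_(i < n) (c * F i) = c * \rsum_(i < n) F i.
Proof. by rewrite big_distrr. Qed.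

Lemma rsum_le n (F G : 'I_n -> R) :
  (forall i, F i <= G i) -> \rsum_(i < n) F i <= \rsum_(i < n) G i.
Proof.
move=> H; apply: (big_ind2 (fun x y => x <= y)) => [|x1 x2 y1 y2|i _]; first lra.
  by move=> ? ?; lra.
exact: H.
Qed.

Lemma rsum_ge0 n (F : 'I_n -> R) : (forall i, 0 <= F i) -> 0 <= \rsum_(i < n) F i.
Proof.
move=> H; apply: (big_ind (fun x => 0 <= x)) => [|x y|i _]; [exact: Rle_refl|by move=> ? ?; exact: Rplus_le_le_0_compat|exact: H].
Qed.

Lemma rsum_abs n (F : 'I_n -> R) :
  Rabs (\rsum_(i < n) F i) <= \rsum_(i < n) Rabs (F i).
Proof.
apply: (big_ind2 (fun x y => Rabs x <= y)) => [|x1 x2 y1 y2 h1 h2|i _].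
- by rewrite Rabs_R0; lra.
- by have := Rabs_triang x1 y1; lra.
- lra.
Qed.

Lemma rsum_const n c : \rsum_(i < n) c = INR n * c.
Proof.
elim: n => [|n IH]; first by rewrite big_ord0 /=; ring.
by rewrite big_ord_recr [LHS]/= IH S_INR; ring.
Qed.

Lemma rsum_term n (F : 'I_n -> R) j :
  (forall i, 0 <= F i) -> F j <= \rsum_(i < n) F i.
Proof.
move=> H; rewrite (bigD1 j) //=.
set S := \big[_/_]_(i < n | _) F i.
suff: 0 <= S by move=> ?; change (F j <= F j + S); lra.
apply: (big_ind (fun x => 0 <= x)) => [|x y|i _]; [exact: Rle_refl|by move=> ? ?; exact: Rplus_le_le_0_compat|exact: H].
Qed.

Lemma rsum_delta n (F : 'I_n -> R) (j : 'I_n) :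
  \rsum_(i < n) (F i * (if i == j then 1 else 0)) = F j.
Proof.
rewrite (bigD1 j) //= eqxx big1; first by ring.
by move=> i /negbTE ->; ring.
Qed.

Lemma vecP n (x y : vec n) : (forall i, x i = y i) -> x = y.
Proof. exact: functional_extensionality. Qed.

Lemma vdotC n (x y : vec n) : vdot x y = vdot y x.
Proof. by apply: eq_bigr => i _; ring. Qed.
Lemma vdotDl n (x y z : vec n) : vdot (vadd x y) z = vdot x z + vdot y z.
Proof. by rewrite /vdot -rsumD; apply: eq_bigr => i _; rewrite /vadd; ring. Qed.
Lemma vdotZl n c (x z : vec n) : vdot (vscal c x) z = c * vdot x z.
Proof. by rewrite /vdot -rsumZ; apply: eq_bigr => i _; rewrite /vscal; ring. Qed.
Lemma vdotDr n (x y z : vec n) : vdot z (vadd x y) = vdot z x + vdot z y.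
Proof. by rewrite !(vdotC _ z) vdotDl. Qed.
Lemma vdotZr n c (x z : vec n) : vdot z (vscal c x) = c * vdot z x.
Proof. by rewrite !(vdotC _ z) vdotZl. Qed.
Lemma vdot_ge0 n (x : vec n) : 0 <= vdot x x.
Proof. by apply: rsum_ge0 => i; apply: Rle_0_sqr. Qed.
Lemma vdot_eq0 n (x : vec n) : vdot x x = 0 -> x = vzero n.
Proof.
move=> h; apply: vecP => i; rewrite /vzero.
have := @rsum_term n (fun i => x i * x i) i (fun i => Rle_0_sqr (x i)).
rewrite -/(vdot x x) h /= => h1.
have h2 : x i * x i = 0 by have := Rle_0_sqr (x i); rewrite /Rsqr; lra.
by case: (Rmult_integral _ _ h2).
Qed.

Lemma vnorm_ge0 n (x : vec n) : 0 <= vnorm x.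
Proof. exact: sqrt_pos. Qed.
Lemma vnorm_sqr n (x : vec n) : vnorm x * vnorm x = vdot x x.
Proof. exact: (sqrt_sqrt _ (vdot_ge0 _ x)). Qed.
Lemma vnorm0 n : vnorm (vzero n) = 0.
Proof.
rewrite /vnorm /vdot big1 ?sqrt_0 // => i _; rewrite /vzero; ring.
Qed.
Lemma vnorm_eq0 n (x : vec n) : vnorm x = 0 -> x = vzero n.
Proof. by move=> h; apply: vdot_eq0; rewrite -vnorm_sqr h; ring. Qed.
Lemma vnormZ n c (x : vec n) : vnorm (vscal c x) = Rabs c * vnorm x.
Proof.
rewrite /vnorm vdotZl vdotZr -Rmult_assoc sqrt_mult; [|exact: Rle_0_sqr|exact: vdot_ge0].
by rewrite -/(Rsqr c) sqrt_Rsqr_abs.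
Qed.

Lemma cauchy_schwarz n (x y : vec n) : Rabs (vdot x y) <= vnorm x * vnorm y.
Proof.
have [y0|y0] := Req_dec (vnorm y) 0.
  have -> : vdot x y = 0.
    rewrite (vnorm_eq0 _ _ y0) /vdot big1 // => i _; rewrite /vzero; ring.
  by rewrite Rabs_R0 y0; lra.
have hy := vnorm_ge0 _ y; have hx := vnorm_ge0 _ x.
apply: Rsqr_incr_0_var; last by nra.
rewrite -Rsqr_abs /Rsqr.
(* The vector is [vnorm y ^ 2] times the component of [x] orthogonal to [y]; expanding its squared
   norm gives the inequality up to the factor [vnorm y ^ 2]. *)
have := vdot_ge0 _ (vadd (vscal (vdot y y) x) (vscal (- vdot x y) y)).
rewrite !(vdotDl, vdotDr, vdotZl, vdotZr) (vdotC _ y x) -!vnorm_sqr.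
set a := vnorm x; set b := vnorm y; set d := vdot x y => h.
have b0 : 0 < b by rewrite /b; lra.
have : 0 <= b * b * (a * a * (b * b) - d * d) by lra.
have bb : 0 < b * b by nra.
move=> h2; have : 0 <= a * a * (b * b) - d * d.
  apply: (Rmult_le_reg_l (b * b)) => //; lra.
lra.
Qed.

Lemma vnorm_triangle n (x y : vec n) : vnorm (vadd x y) <= vnorm x + vnorm y.
Proof.
have hy := vnorm_ge0 _ y; have hx := vnorm_ge0 _ x.
apply: Rsqr_incr_0_var; last by lra.
rewrite /Rsqr vnorm_sqr !(vdotDl, vdotDr) (vdotC _ y x) -!vnorm_sqr.
have := cauchy_schwarz _ x y; have := Rle_abs (vdot x y); nra.
Qed.

Lemma vdist_sym n (x y : vec n) : vdist x y = vdist y x.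
Proof.
rewrite /vdist; have -> : vsub x y = vscal (-1) (vsub y x).
  by apply: vecP => i; rewrite /vsub /vscal; ring.
rewrite vnormZ Rabs_Ropp Rabs_R1; ring.
Qed.
Lemma vdist_triangle n (y x z : vec n) : vdist x z <= vdist x y + vdist y z.
Proof.
rewrite /vdist; have -> : vsub x z = vadd (vsub x y) (vsub y z).
  by apply: vecP => i; rewrite /vsub /vadd; ring.
exact: vnorm_triangle.
Qed.
Lemma vdist_ge0 n (x y : vec n) : 0 <= vdist x y.
Proof. exact: vnorm_ge0. Qed.
Lemma vdistxx n (x : vec n) : vdist x x = 0.
Proof.
by rewrite /vdist -(vnorm0 n); congr vnorm; apply: vecP => i; rewrite /vsub /vzero; ring.
Qed.
Lemma vdist_eq0 n (x y : vec n) : vdist x y = 0 -> x = y.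
Proof.
move=> /vnorm_eq0 h; apply: vecP => i.
by have := congr1 (fun f => f i) h; rewrite /vsub /vzero; lra.
Qed.
Lemma vdist_lipschitz n (z x y : vec n) : Rabs (vdist x z - vdist y z) <= vdist x y.
Proof.
have := vdist_triangle _ y x z; have := vdist_triangle _ x y z.
rewrite (vdist_sym _ y x) => ? ?; apply: Rabs_le; lra.
Qed.
Lemma vdist_add n (x h : vec n) : vdist (vadd x h) x = vnorm h.
Proof. by congr vnorm; apply: vecP => i; rewrite /vsub /vadd; ring. Qed.
Lemma vadd_sub n (x y : vec n) : vadd x (vsub y x) = y.
Proof. by apply: vecP => i; rewrite /vsub /vadd; ring. Qed.

Lemma coord_le_vnorm n (x : vec n) i : Rabs (x i) <= vnorm x.
Proof.
rewrite -sqrt_Rsqr_abs; apply: sqrt_le_1_alt.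
exact: (@rsum_term n (fun i => x i * x i) i (fun i => Rle_0_sqr (x i))).
Qed.

Lemma vnorm_le_coord n (x y : vec n) :
  (forall i, Rabs (x i) <= Rabs (y i)) -> vnorm x <= vnorm y.
Proof.
move=> h; apply: sqrt_le_1_alt; apply: rsum_le => i.
exact: (Rsqr_le_abs_1 _ _ (h i)).
Qed.

Lemma vnorm_le_sup n (x : vec n) e :
  0 <= e -> (forall i, Rabs (x i) <= e) -> vnorm x <= INR n * e.
Proof.
move=> e0 h; have hn := pos_INR n.
have hne : 0 <= INR n * e by nra.
apply: Rsqr_incr_0_var => //; rewrite /Rsqr vnorm_sqr.
apply: Rle_trans (_ : \rsum_(i < n) (e * e) <= _).
  apply: rsum_le => i; apply: (Rsqr_le_abs_1 (x i) e); rewrite (Rabs_right e); [exact: h|lra].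
(* Passing from [n e^2] to [n^2 e^2] uses [1 <= n], so dimension zero is split off. *)
rewrite rsum_const; clear h; case: n hn hne x => [|m] hn hne _; first by rewrite /=; lra.
have : 1 <= INR m.+1 by rewrite S_INR; have := pos_INR m; lra.
move=> h1; have : INR m.+1 * (e * e) * 1 <= INR m.+1 * (e * e) * INR m.+1.
  apply: Rmult_le_compat_l => //; nra.
lra.
Qed.

(** * Taylor expansions *)

Lemma MVT_abs (f df : R -> R) (c e : R) :
  (forall t, Rabs t <= Rabs c -> derivable_pt_lim f t (df t)) ->
  (forall t, Rabs t <= Rabs c -> Rabs (df t) <= e) ->
  Rabs (f c - f 0) <= e * Rabs c.
Proof.
move=> hd hb.
have inI t : Rmin 0 c <= t <= Rmax 0 c -> Rabs t <= Rabs c.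
  rewrite /Rmin /Rmax; case: Rle_dec => ? ?.
    by rewrite !Rabs_right; lra.
  by rewrite !Rabs_left1; lra.
have [] := @MVT_gen f 0 c df.
- by move=> t ht; apply/is_derive_Reals/hd/inI; lra.
- move=> t ht; apply: derivable_continuous_pt; exists (df t); exact/hd/inI.
- move=> t [ht ->]; rewrite Rminus_0_r Rabs_mult.
  by apply: Rmult_le_compat_r; [exact: Rabs_pos|exact/hb/inI].
Qed.

(** The second derivative is given at [s] only. Differentiability of [df] at [s] says that the
    derivative of the remainder is [o(h)], and the mean value inequality integrates this to
    [o(h^2)]. *)
Lemma taylor2_at (f df : R -> R) (s X : R) :
  (forall t, derivable_pt_lim f t (df t)) -> derivable_pt_lim df s X ->
  forall eps, 0 < eps -> exists d, 0 < d /\ forall t, Rabs (t - s) < d ->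
    Rabs (f t - f s - df s * (t - s) - X / 2 * (t - s) ^ 2) <= eps * (t - s) ^ 2.
Proof.
move=> hf hdf eps e0; have [d hd] := hdf eps e0.
exists d; split; first exact: cond_pos.
move=> t ht.
pose G h := f (s + h) - (df s * h + X / 2 * h ^ 2).
have hG h : derivable_pt_lim G h (df (s + h) - (df s + X * h)).
  have h1 : is_derive (fun h => f (s + h)) h (df (s + h)).
    have := hf (s + h); rewrite -is_derive_Reals => h1.
    have h2 : is_derive (fun h => s + h) h 1 by auto_derive.
    by have := @is_derive_comp R_AbsRing _ f _ h _ _ h1 h2; rewrite /scal /= /mult /= Rmult_1_l.
  have h2 : is_derive (fun h => df s * h + X / 2 * h ^ 2) h (df s + X * h).
    by auto_derive => //; field.
  by apply: derivable_pt_lim_minus; rewrite -is_derive_Reals.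
have := @MVT_abs G _ (t - s) (eps * Rabs (t - s)) (fun u _ => hG u).
have -> : G (t - s) - G 0 = f t - f s - df s * (t - s) - X / 2 * (t - s) ^ 2.
  by rewrite /G Rplus_0_r (_ : s + (t - s) = t); ring.
have -> : eps * Rabs (t - s) * Rabs (t - s) = eps * (t - s) ^ 2.
  by rewrite -(pow2_abs (t - s)); ring.
apply=> u hu; have [->|u0] := Req_dec u 0.
  rewrite Rplus_0_r (_ : df s - _ = 0); last by ring.
  by rewrite Rabs_R0; apply: Rmult_le_pos; [lra|exact: Rabs_pos].
have := hd u u0 (Rle_lt_trans _ _ _ hu ht).
rewrite (_ : df (s + u) - (df s + X * u) = ((df (s + u) - df s) / u - X) * u); last by field.
move=> h; rewrite Rabs_mult; apply: Rmult_le_compat; try exact: Rabs_pos; lra.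
Qed.

(** The truncations of [h] are the vertices of a path from [0] to [h] that changes one coordinate at
    a time. *)
Definition vtrunc {n} (m : nat) (h : vec n) : vec n := fun i => if (i < m)%N then h i else 0.

Lemma vtrunc_full n (h : vec n) : vtrunc n h = h.
Proof. by apply: vecP => i; rewrite /vtrunc ltn_ord. Qed.

Lemma vtruncS n (h : vec n) (k : 'I_n) :
  vtrunc k.+1 h = vadd (vtrunc k h) (vscal (h k) (ebasis k)).
Proof.
apply: vecP => i; rewrite /vtrunc /vadd /vscal /ebasis ltnS leq_eqVlt.
have [->|ne] := eqVneq i k; first by rewrite eqxx ltnn /=; ring.
by rewrite -(inj_eq val_inj) /= in ne; rewrite (negbTE ne) /=; case: ifP => _; ring.
Qed.

(** Continuous partial derivatives imply differentiability: along the path of truncations each edge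
    is parallel to an axis, and the mean value inequality on it costs at most [e * vnorm h]. *)
Lemma first_order_expansion n (O : vset n) (f : vec n -> R) (g : vec n -> vec n) x :
  vopen O -> O x -> (forall z, O z -> forall k, has_partial f k z (g z k)) ->
  (forall k, cont_on O (fun z => g z k)) ->
  forall eps, 0 < eps -> exists d, 0 < d /\ forall h, vnorm h < d ->
    O (vadd x h) /\
    Rabs (f (vadd x h) - f x - vdot (g x) h) <= eps * vnorm h.
Proof.
move=> oO Ox hp hc eps e0.
have [r [r0 hr]] := oO x Ox.
(* There are [n] edges, each with error [e * vnorm h]; the [+ 1] keeps the denominator positive when
   [n = 0]. *)
pose e := eps / (INR n + 1).
have hn := pos_INR n.
have e'0 : 0 < e by apply: Rdiv_lt_0_compat; lra.
have [d [d0 hd]] : exists d, 0 < d /\ forall k y, O y -> vdist y x < d ->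
    Rabs (g y k - g x k) < e.
  have hk m : exists d, 0 < d /\ forall k : 'I_n, (k < m)%N -> forall y, O y ->
     vdist y x < d -> Rabs (g y k - g x k) < e.
    elim: m => [|m [d [d0 IH]]]; first by exists 1; split; [lra|].
    have [mn|mn] := ltnP m n; last first.
      by exists d; split=> // k _; apply: IH; apply: leq_trans mn.
    have [d' [d'0 hd']] := hc (Ordinal mn) x Ox e e'0.
    exists (Rmin d d'); split; first exact: Rmin_pos.
    move=> k; rewrite ltnS leq_eqVlt => /orP[/eqP km|km] y Oy hy.
      have -> : k = Ordinal mn by exact: val_inj.
      by apply: hd' => //; apply: Rlt_le_trans hy (Rmin_r _ _).
    by apply: IH => //; apply: Rlt_le_trans hy (Rmin_l _ _).
  by have [d [d0 hd]] := hk n; exists d; split=> // k y; apply: hd.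
exists (Rmin r d); split; first exact: Rmin_pos.
move=> h hh.
have near z : vnorm z <= vnorm h -> O (vadd x z) /\ forall k, Rabs (g (vadd x z) k - g x k) < e.
  move=> hz; have Oz : O (vadd x z).
    by apply: hr; rewrite vdist_add; have := Rmin_l r d; lra.
  by split=> // k; apply: hd => //; rewrite vdist_add; have := Rmin_r r d; lra.
split; first by case: (near h) => //; lra.
have main m : (m <= n)%N ->
  Rabs (f (vadd x (vtrunc m h)) - f x - vdot (g x) (vtrunc m h)) <= INR m * (e * vnorm h).
  elim: m => [_|m IH mn].
    have -> : vadd x (vtrunc 0 h) = x by apply: vecP => i; rewrite /vadd /vtrunc ltn0; ring.
    rewrite (_ : vdot _ _ = 0); first by rewrite (_ : _ - _ - _ = 0) ?Rabs_R0 /=; lra.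
    by rewrite /vdot big1 // => i _; rewrite /vtrunc ltn0; ring.
  have {IH} := IH (ltnW mn).
  pose k := Ordinal mn; rewrite -/(nat_of_ord k) -[m.+1]/(k.+1) vtruncS vdotDr vdotZr.
  have -> : vdot (g x) (ebasis k) = g x k by rewrite /vdot /ebasis rsum_delta.
  set z := vtrunc k h.
  (* With the linear part removed, the derivative of [F] is a difference of values of one partial
     derivative. By [hz] the edge stays within distance [vnorm h] of [x], where this difference is
     below [e]. *)
  pose F t := f (vadd x (vadd z (vscal t (ebasis k)))) - g x k * t.
  have hz t : Rabs t <= Rabs (h k) -> vnorm (vadd z (vscal t (ebasis k))) <= vnorm h.
    move=> ht; apply: vnorm_le_coord => i; rewrite /z /vtrunc /vadd /vscal /ebasis.
    have [->|ne] := eqVneq i k; first by rewrite ltnn Rplus_0_l Rmult_1_r.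
    rewrite Rmult_0_r Rplus_0_r; case: ifP => _; first by lra.
    by rewrite Rabs_R0; exact: Rabs_pos.
  have hF t : Rabs t <= Rabs (h k) ->
    derivable_pt_lim F t (g (vadd x (vadd z (vscal t (ebasis k)))) k - g x k).
    move=> ht; have [Oz _] := near _ (hz t ht).
    apply: derivable_pt_lim_minus; last first.
      by rewrite -is_derive_Reals; auto_derive => //; ring.
    move=> ep ep0; have [dd hdd] := hp _ Oz k ep ep0; exists dd => u u0 hu.
    have := hdd u u0 hu.
    have -> : vadd (vadd x (vadd z (vscal t (ebasis k)))) (vscal (0 + u) (ebasis k)) =
        vadd x (vadd z (vscal (t + u) (ebasis k))).
      by apply: vecP => i; rewrite /vadd /vscal; ring.
    have -> // : vadd (vadd x (vadd z (vscal t (ebasis k)))) (vscal 0 (ebasis k)) =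
        vadd x (vadd z (vscal t (ebasis k))).
    by apply: vecP => i; rewrite /vadd /vscal; ring.
  have hm := @MVT_abs F _ (h k) e hF.
  have {}hm : Rabs (F (h k) - F 0) <= e * Rabs (h k).
    by apply: hm => t ht; left; have [_] := near _ (hz t ht); apply.
  have h1 : e * Rabs (h k) <= e * vnorm h.
    by apply: Rmult_le_compat_l; [lra|exact: coord_le_vnorm].
  have z0 : vadd z (vscal 0 (ebasis k)) = z.
    by apply: vecP => i; rewrite /vadd /vscal; ring.
  rewrite S_INR => h2; move: hm; rewrite /F z0 => h3.
  set A := f (vadd x (vadd z _)) in h3 *.
  rewrite (_ : A - f x - _ = (f (vadd x z) - f x - vdot (g x) z) +
     (A - g x k * h k - (f (vadd x z) - g x k * 0))); last by ring.
  apply: Rle_trans (Rabs_triang _ _) _; change (INR k) with (INR m); lra.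
have := main n (leqnn n); rewrite vtrunc_full => h1.
apply: Rle_trans h1 _.
have nh := vnorm_ge0 _ h.
rewrite -Rmult_assoc; apply: Rmult_le_compat_r => //.
have : e * (INR n + 1) = eps by rewrite /e; field; lra.
nra.
Qed.

(** [C2_with] records continuity of the second derivatives only; this recovers continuity of the
    gradient. *)
Lemma cont_on_of_partials n (O : vset n) (f : vec n -> R) (g : vec n -> vec n) :
  vopen O -> (forall z, O z -> forall k, has_partial f k z (g z k)) ->
  (forall k, cont_on O (fun z => g z k)) -> cont_on O f.
Proof.
move=> oO hp hc x Ox eps e0.
have [d [d0 hd]] := first_order_expansion _ O f g x oO Ox hp hc 1 Rlt_0_1.
pose K := 1 + vnorm (g x).
have K0 : 0 < K by rewrite /K; have := vnorm_ge0 _ (g x); lra.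
exists (Rmin d (eps / K)); split; first by apply: Rmin_pos => //; exact: Rdiv_lt_0_compat.
move=> y Oy hy.
have hyd : vnorm (vsub y x) < d by apply: Rlt_le_trans hy (Rmin_l _ _).
have hye : vnorm (vsub y x) < eps / K by apply: Rlt_le_trans hy (Rmin_r _ _).
have [_] := hd _ hyd; rewrite vadd_sub => h1.
have h2 := cauchy_schwarz _ (g x) (vsub y x).
set v := vdot _ _ in h1 h2.
rewrite (_ : f y - f x = (f y - f x - v) + v); last by ring.
apply: Rle_lt_trans (Rabs_triang _ _) _.
have : K * vnorm (vsub y x) < K * (eps / K) by apply: Rmult_lt_compat_l.
rewrite (_ : K * (eps / K) = eps); last by field; lra.
rewrite /K; lra.
Qed.

Definition bil {n} (H : 'I_n -> 'I_n -> R) (x y : vec n) : R :=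
  vdot x (fun k => vdot (H k) y).

Lemma quad_bil n (H : 'I_n -> 'I_n -> R) v : quad H v = bil H v v.
Proof.
rewrite /quad /bil /vdot; apply: eq_bigr => k _; rewrite -rsumZ.
by apply: eq_bigr => l _; ring.
Qed.

Lemma bilDl n (H : 'I_n -> 'I_n -> R) x y z : bil H (vadd x y) z = bil H x z + bil H y z.
Proof. by rewrite /bil vdotDl. Qed.
Lemma bilZl n (H : 'I_n -> 'I_n -> R) c y z : bil H (vscal c y) z = c * bil H y z.
Proof. by rewrite /bil vdotZl. Qed.
Lemma bilDr n (H : 'I_n -> 'I_n -> R) x y z : bil H z (vadd x y) = bil H z x + bil H z y.
Proof. by rewrite /bil /vdot -rsumD; apply: eq_bigr => k _; rewrite -/(vdot _ _) vdotDr /vdot; ring. Qed.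
Lemma bilZr n (H : 'I_n -> 'I_n -> R) c y z : bil H z (vscal c y) = c * bil H z y.
Proof. by rewrite /bil /vdot -rsumZ; apply: eq_bigr => k _; rewrite -/(vdot _ _) vdotZr /vdot; ring. Qed.

(** The constant is the Frobenius norm of [H]; Cauchy-Schwarz is applied once to the outer sum and
    once in each row. *)
Lemma bil_bounded n (H : 'I_n -> 'I_n -> R) :
  exists K, 0 <= K /\ forall x y, Rabs (bil H x y) <= K * (vnorm x * vnorm y).
Proof.
exists (vnorm (fun k => vnorm (H k))); split=> [|x y]; first exact: vnorm_ge0.
apply: Rle_trans (cauchy_schwarz _ _ _) _.
rewrite (_ : _ * (_ * _) = vnorm x * (vnorm y * vnorm (fun k => vnorm (H k)))); last by ring.
apply: Rmult_le_compat_l; first exact: vnorm_ge0.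
have -> : vnorm y * vnorm (fun k => vnorm (H k)) = vnorm (vscal (vnorm y) (fun k => vnorm (H k))).
  by rewrite vnormZ Rabs_right //; exact/Rle_ge/vnorm_ge0.
apply: vnorm_le_coord => k; apply: Rle_trans (cauchy_schwarz _ _ _) _.
rewrite /vscal Rabs_mult !Rabs_right; try exact/Rle_ge/vnorm_ge0.
by apply: Req_le; ring.
Qed.

(** The mean value inequality is applied on the segment from [x] to [x + h] to [phi] minus its
    quadratic model. The derivative there is the first-order remainder of the gradient, paired with
    [h]. *)
Lemma second_order_expansion n (O : vset n) phi Dphi D2phi x :
  vopen O -> @C2_with n O phi Dphi D2phi -> O x ->
  forall eps, 0 < eps -> exists d, 0 < d /\ forall h, vnorm h < d ->
    Rabs (phi (vadd x h) - phi x - vdot (Dphi x) h - quad (D2phi x) h / 2)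
      <= eps * vnorm h ^ 2.
Proof.
move=> oO [hp [hp2 hc2]] Ox eps e0.
have hc k : cont_on O (fun z => Dphi z k).
  apply: (cont_on_of_partials _ O (fun y => Dphi y k) (fun z l => D2phi z k l)) => //.
  by move=> z Oz l; exact: hp2.
pose e := eps / (INR n + 1); have hn := pos_INR n.
have e'0 : 0 < e by apply: Rdiv_lt_0_compat; lra.
have hk m : exists d, 0 < d /\ forall k : 'I_n, (k < m)%N -> forall h, vnorm h < d ->
   O (vadd x h) /\ Rabs (Dphi (vadd x h) k - Dphi x k - vdot (D2phi x k) h) <= e * vnorm h.
  elim: m => [|m [d [d0 IH]]]; first by exists 1; split; [lra|].
  have [mn|mn] := ltnP m n; last first.
    by exists d; split=> // k _; apply: IH; apply: leq_trans mn.
  pose k0 := Ordinal mn.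
  have [d' [d'0 hd']] := first_order_expansion _ O (fun y => Dphi y k0) (fun z l => D2phi z k0 l) x
     oO Ox (fun z Oz l => hp2 z Oz k0 l) (fun l => hc2 k0 l) e e'0.
  exists (Rmin d d'); split; first exact: Rmin_pos.
  move=> k; rewrite ltnS leq_eqVlt => /orP[/eqP km|km] h hh.
    have -> : k = k0 by exact: val_inj.
    by apply: hd' => //; apply: Rlt_le_trans hh (Rmin_r _ _).
  by apply: IH => //; apply: Rlt_le_trans hh (Rmin_l _ _).
have [r [r0 hr]] := oO x Ox.
have [d [d0 hd]] := hk n.
exists (Rmin r d); split; first exact: Rmin_pos.
move=> h hh; have hhr := Rlt_le_trans _ _ _ hh (Rmin_l _ _).
have hhd := Rlt_le_trans _ _ _ hh (Rmin_r _ _).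
have h0 := vnorm_ge0 _ h.
have hth t : Rabs t <= 1 -> vnorm (vscal t h) <= vnorm h.
  by move=> ht; rewrite vnormZ; nra.
pose F t := phi (vadd x (vscal t h)) - (vdot (Dphi x) h * t + quad (D2phi x) h / 2 * t ^ 2).
pose dF t := vdot (Dphi (vadd x (vscal t h))) h - (vdot (Dphi x) h + quad (D2phi x) h * t).
have hF t : Rabs t <= Rabs 1 -> derivable_pt_lim F t (dF t).
  rewrite Rabs_R1 => ht.
  have h2 : is_derive (fun t => vdot (Dphi x) h * t + quad (D2phi x) h / 2 * t ^ 2) t
      (vdot (Dphi x) h + quad (D2phi x) h * t) by auto_derive => //; field.
  have h1 : is_derive (fun t => phi (vadd x (vscal t h))) t (vdot (Dphi (vadd x (vscal t h))) h).
    rewrite is_derive_Reals => ep ep0.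
    have Oz : O (vadd x (vscal t h)).
      by apply: hr; rewrite vdist_add; have := hth t ht; lra.
    (* The chain rule along the segment comes from the first-order expansion at the point reached.
       The factor [2 * (vnorm h + 1)] makes the final bound strict and also covers [h = 0]. *)
    have ep'0 : 0 < ep / (2 * (vnorm h + 1)) by apply: Rdiv_lt_0_compat; lra.
    have [dd [dd0 hdd]] := first_order_expansion _ O phi Dphi _ oO Oz hp hc _ ep'0.
    have q0 : 0 < dd / (vnorm h + 1) by apply: Rdiv_lt_0_compat; lra.
    exists (mkposreal _ q0) => u u0 /= hu.
    have hu1 : vnorm (vscal u h) < dd.
      rewrite vnormZ.
      have h5 : Rabs u * (vnorm h + 1) < dd / (vnorm h + 1) * (vnorm h + 1) by apply: Rmult_lt_compat_r; lra.
      have h6 : dd / (vnorm h + 1) * (vnorm h + 1) = dd by field; lra.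
      have := Rabs_pos u; lra.
    have [_] := hdd _ hu1.
    have -> : vadd (vadd x (vscal t h)) (vscal u h) = vadd x (vscal (t + u) h).
      by apply: vecP => i; rewrite /vadd /vscal; ring.
    rewrite vdotZr vnormZ => h3.
    set A := phi _ - phi _ in h3 *.
    rewrite (_ : A / u - _ = (A - u * vdot (Dphi (vadd x (vscal t h))) h) / u); last by field.
    rewrite Rabs_div //; have u1 := Rabs_pos_lt u u0.
    apply: (Rmult_lt_reg_r (Rabs u)) => //.
    rewrite /Rdiv Rmult_assoc Rinv_l ?Rmult_1_r; last lra.
    apply: Rle_lt_trans h3 _.
    have -> : ep / (2 * (vnorm h + 1)) * (Rabs u * vnorm h) = (ep * Rabs u) * (vnorm h / (2 * (vnorm h + 1))).
      by field; lra.
    have : vnorm h / (2 * (vnorm h + 1)) < 1.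
      by apply: (Rmult_lt_reg_r (2 * (vnorm h + 1))); [lra|rewrite /Rdiv Rmult_assoc Rinv_l; lra].
    have : 0 < ep * Rabs u by nra.
    nra.
  by apply: derivable_pt_lim_minus; rewrite -is_derive_Reals.
have := MVT_abs F dF 1 (eps * vnorm h ^ 2) hF.
rewrite Rabs_R1 Rmult_1_r.
have -> : F 1 - F 0 = phi (vadd x h) - phi x - vdot (Dphi x) h - quad (D2phi x) h / 2.
  rewrite /F; have -> : vadd x (vscal 1 h) = vadd x h by apply: vecP => i; rewrite /vadd /vscal; ring.
  by have -> : vadd x (vscal 0 h) = x by [apply: vecP => i; rewrite /vadd /vscal; ring]; ring.
apply=> t ht; rewrite /dF quad_bil /bil.
have -> : vdot (Dphi (vadd x (vscal t h))) h
    - (vdot (Dphi x) h + vdot h (fun k => vdot (D2phi x k) h) * t) =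
  \rsum_(k < n) ((Dphi (vadd x (vscal t h)) k - Dphi x k - vdot (D2phi x k) (vscal t h)) * h k).
  rewrite {1 2 3}/vdot [RHS](eq_bigr (fun k => (Dphi (vadd x (vscal t h)) k * h k + (-1) * (Dphi x k * h k))
     + (- t) * (h k * vdot (D2phi x k) h))); last by move=> k _; rewrite vdotZr; ring.
  by rewrite !rsumD !rsumZ; ring.
apply: Rle_trans (rsum_abs _ _) _.
apply: Rle_trans (_ : \rsum_(k < n) (e * vnorm h ^ 2) <= _).
  apply: rsum_le => k; rewrite Rabs_mult.
  have hk1 := coord_le_vnorm _ h k; have ht' := hth t ht.
  have [_ hk2] := hd k (ltn_ord k) (vscal t h) (Rle_lt_trans _ _ _ ht' hhd).
  have : e * vnorm (vscal t h) <= e * vnorm h by apply: Rmult_le_compat_l; lra.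
  move=> h3; have h4 := Rle_trans _ _ _ hk2 h3.
  rewrite (_ : e * vnorm h ^ 2 = e * vnorm h * vnorm h); last by ring.
  by apply: Rmult_le_compat => //; exact: Rabs_pos.
rewrite rsum_const -Rmult_assoc; apply: Rmult_le_compat_r; first exact: pow2_ge_0.
have : e * (INR n + 1) = eps by rewrite /e; field; lra.
nra.
Qed.

(** * Compactness *)

Definition seq_cv (v : nat -> R) (l : R) : Prop :=
  forall eps, 0 < eps -> exists N, forall m, (N <= m)%N -> Rabs (v m - l) < eps.

Lemma inv_succ_small eps : 0 < eps -> exists N, forall m, (N <= m)%N -> / (INR m + 1) < eps.
Proof.
move=> /archimed_cor1 [N [hN N0]]; exists N => m /leP/le_INR Nm.
apply: Rlt_trans hN; apply: Rinv_lt_contravar; last lra.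
by have := lt_0_INR _ N0; nra.
Qed.

Lemma seq_cv_sub (v : nat -> R) l (phi : nat -> nat) :
  (forall m, (m <= phi m)%N) -> seq_cv v l -> seq_cv (fun m => v (phi m)) l.
Proof.
move=> hphi hv eps e0; have [N hN] := hv eps e0; exists N => m Nm.
exact/hN/(leq_trans Nm).
Qed.

(* The extraction is only required to dominate the identity, which suffices to compose extractions. *)
Lemma bounded_seq_extraction (v : nat -> R) M : (forall m, Rabs (v m) <= M) ->
  exists (phi : nat -> nat) l, (forall m, (m <= phi m)%N) /\ seq_cv (fun m => v (phi m)) l.
Proof.
move=> hM.
have [l hl] := Bolzano_Weierstrass v _ (compact_P3 (- M) M)
  (fun m => proj1 (Rabs_le_between _ _) (hM m)).
have hex m : exists p, (m <= p)%N /\ Rabs (v p - l) < / (INR m + 1).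
  have e0 : 0 < / (INR m + 1) by apply: Rinv_0_lt_compat; have := pos_INR m; lra.
  have [|p [/leP mp hp]] := hl (fun y => Rabs (y - l) < / (INR m + 1)) m; last by exists p.
  by exists (mkposreal _ e0) => y.
exists (fun m => proj1_sig (constructive_indefinite_description _ (hex m))), l.
split=> [m|eps e0]; first by case: constructive_indefinite_description => p [].
have [N hN] := inv_succ_small _ e0; exists N => m Nm.
case: constructive_indefinite_description => p [_ /= hp].
exact: Rlt_trans hp (hN m Nm).
Qed.

(** Coordinates are treated one after another; a further extraction preserves the convergence of
    those already handled. *)
Lemma bounded_vec_extraction n (v : nat -> vec n) M : (forall m i, Rabs (v m i) <= M) ->
  exists (phi : nat -> nat) (l : vec n), (forall m, (m <= phi m)%N) /\
    forall i, seq_cv (fun m => v (phi m) i) (l i).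
Proof.
move=> hM.
have hk k : exists (phi : nat -> nat) (l : vec n), (forall m, (m <= phi m)%N) /\
    forall i : 'I_n, (i < k)%N -> seq_cv (fun m => v (phi m) i) (l i).
  elim: k => [|k [phi [l [h1 h2]]]]; first by exists id, (vzero n).
  have [kn|kn] := ltnP k n; last first.
    by exists phi, l; split=> // i _; apply: h2; apply: leq_trans kn.
  pose k0 := Ordinal kn.
  have [psi [a [h3 h4]]] := bounded_seq_extraction (fun m => v (phi m) k0) M (fun m => hM _ _).
  exists (fun m => phi (psi m)), (fun i => if i == k0 then a else l i); split.
    by move=> m; apply: leq_trans (h3 m) (h1 _).
  move=> i; rewrite ltnS leq_eqVlt => /orP[/eqP ik|ik].
    have -> : i = k0 by exact: val_inj.
    by rewrite eqxx.
  have [->|_] := eqVneq i k0; first exact: h4.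
  exact: (seq_cv_sub (fun m => v (phi m) i) _ psi h3 (h2 i ik)).
have [phi [l [h1 h2]]] := hk n.
by exists phi, l; split=> // i; apply: h2.
Qed.

Lemma vec_cv_vdist n (v : nat -> vec n) l : (forall i, seq_cv (fun m => v m i) (l i)) ->
  seq_cv (fun m => vdist (v m) l) 0.
Proof.
move=> hv eps e0.
have hn := pos_INR n.
have e'0 : 0 < eps / (INR n + 1) by apply: Rdiv_lt_0_compat; lra.
have hk k : exists N, forall m, (N <= m)%N -> forall i : 'I_n, (i < k)%N ->
    Rabs (v m i - l i) < eps / (INR n + 1).
  elim: k => [|k [N hN]]; first by exists 0%N.
  have [kn|kn] := ltnP k n; last first.
    by exists N => m Nm i _; apply: hN => //; apply: leq_trans kn.
  have [N' hN'] := hv (Ordinal kn) _ e'0.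
  exists (maxn N N') => m; rewrite geq_max => /andP[Nm N'm] i.
  rewrite ltnS leq_eqVlt => /orP[/eqP ik|ik]; last exact: hN.
  have -> : i = Ordinal kn by exact: val_inj.
  exact: hN'.
have [N hN] := hk n; exists N => m Nm.
rewrite Rminus_0_r Rabs_right; last exact/Rle_ge/vdist_ge0.
apply: Rle_lt_trans (vnorm_le_sup _ _ (eps / (INR n + 1)) _ _) _; first lra.
  by move=> i; left; apply: hN.
apply: (Rmult_lt_reg_r (INR n + 1)); first lra.
rewrite Rmult_assoc /Rdiv Rmult_assoc Rinv_l; nra.
Qed.

(** Direct method on the product of a closed ball and an interval of shifts: a maximizing sequence
    has a convergent extraction, and upper semicontinuity makes its limit a maximum point. *)
Lemma usc_attains_max n (x0 : vec n) r rho (f : vec n -> R -> R) :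
  0 <= r -> 0 <= rho ->
  (forall x t, vdist x x0 <= r -> Rabs t <= rho -> forall eps, 0 < eps ->
    exists d, 0 < d /\ forall y s, vdist y x0 <= r -> Rabs s <= rho ->
      vdist y x < d -> Rabs (s - t) < d -> f y s < f x t + eps) ->
  exists x t, vdist x x0 <= r /\ Rabs t <= rho /\
    forall y s, vdist y x0 <= r -> Rabs s <= rho -> f y s <= f x t.
Proof.
move=> r0 rho0 husc.
pose K (z : vec n * R) := vdist z.1 x0 <= r /\ Rabs z.2 <= rho.
(* The second alternative is there because the supremum is not yet known to be finite. *)
pose Q m (z : vec n * R) := K z /\
  ((forall w, K w -> f w.1 w.2 <= f z.1 z.2 + / (INR m + 1)) \/ INR m <= f z.1 z.2).
have hQ m : exists z, Q m z.
  have [[z [Kz hz]]|hno] := classic (exists z, K z /\ INR m <= f z.1 z.2).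
    by exists z; split=> //; right.
  pose E a := exists z, K z /\ a = f z.1 z.2.
  have [||lub [hub hlub]] := completeness E.
  - exists (INR m) => _ [z [Kz ->]]; apply: Rnot_lt_le => hlt.
    by apply: hno; exists z; split=> //; lra.
  - exists (f x0 0), (x0, 0); split=> //; split=> /=; first by rewrite vdistxx.
    by rewrite Rabs_R0.
  have e0 : 0 < / (INR m + 1) by apply: Rinv_0_lt_compat; have := pos_INR m; lra.
  have [[z [Kz hz]]|hno2] := classic (exists z, K z /\ lub - / (INR m + 1) < f z.1 z.2).
    exists z; split=> //; left=> w Kw.
    by have := hub (f w.1 w.2) (ex_intro _ w (conj Kw erefl)); lra.
  have : lub <= lub - / (INR m + 1); last lra.
  apply: hlub => _ [z [Kz ->]]; apply: Rnot_lt_le => hlt.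
  by apply: hno2; exists z.
pose z m := proj1_sig (constructive_indefinite_description _ (hQ m)).
have hz m : Q m (z m) by rewrite /z; case: constructive_indefinite_description.
have [|phi [l [hphi hl]]] := bounded_vec_extraction _ (fun m => (z m).1) (r + vnorm x0).
  move=> m i; have [[h1 _] _] := hz m.
  apply: Rle_trans (coord_le_vnorm _ _ _) _.
  have -> : (z m).1 = vadd (vsub (z m).1 x0) x0.
    by apply: vecP => j; rewrite /vadd /vsub; ring.
  by apply: Rle_trans (vnorm_triangle _ _ _) _; apply: Rplus_le_compat_r.
have [|psi [t [hpsi ht]]] := bounded_seq_extraction (fun m => (z (phi m)).2) rho.
  by move=> m; have [[_ h1] _] := hz (phi m).
pose chi m := phi (psi m).
have hchi m : (m <= chi m)%N by apply: leq_trans (hpsi m) (hphi _).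
have hx : seq_cv (fun m => vdist (z (chi m)).1 l) 0.
  exact/(seq_cv_sub (fun m => vdist (z (phi m)).1 l) 0 psi hpsi)/vec_cv_vdist.
have Kl : vdist l x0 <= r.
  apply: Rnot_lt_le => hlt; have e0 : 0 < vdist l x0 - r by lra.
  have [N /(_ N (leqnn N))] := hx _ e0; rewrite Rminus_0_r.
  have [[h1 _] _] := hz (chi N); have := vdist_triangle _ (z (chi N)).1 l x0.
  rewrite (vdist_sym _ l (z _).1) => h2 /Rabs_def2; lra.
have Kt : Rabs t <= rho.
  apply: Rnot_lt_le => hlt; have e0 : 0 < Rabs t - rho by lra.
  have [N /(_ N (leqnn N))] := ht _ e0.
  have [[_ h1] _] := hz (chi N); rewrite -/(chi N).
  rewrite Rabs_minus_sym => h2; have := Rabs_triang_inv t (z (chi N)).2; lra.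
exists l, t; split=> //; split=> // y s hy hs; apply: Rnot_lt_le => hlt.
(* If [(y, s)] beats the limit point, half of the gap goes to upper semicontinuity and half to the
   defect of the maximizing sequence; [N4] rules out the unbounded alternative of [Q]. *)
have e0 : 0 < (f y s - f l t) / 2 by lra.
have [d [d0 hd]] := husc l t Kl Kt _ e0.
have [N1 hN1] := hx d d0; have [N2 hN2] := ht d d0; have [N3 hN3] := inv_succ_small _ e0.
have [N4 hN4] : exists N, forall m, (N <= m)%N -> f l t + (f y s - f l t) / 2 < INR m.
  have [N hN] := INR_unbounded (f l t + (f y s - f l t) / 2).
  by exists N => m /leP/le_INR; lra.
pose m := (maxn (maxn N1 N2) (maxn N3 N4)).
have m1 : (N1 <= m)%N by rewrite /m !leq_max leqnn.
have m2 : (N2 <= m)%N by rewrite /m !leq_max leqnn orbT.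
have m3 : (N3 <= m)%N by rewrite /m !leq_max leqnn !orbT.
have m4 : (N4 <= m)%N by rewrite /m !leq_max leqnn !orbT.
have [[k1 k2] k3] := hz (chi m).
have : f (z (chi m)).1 (z (chi m)).2 < f l t + (f y s - f l t) / 2.
  apply: hd => //; last exact: hN2.
  by have := hN1 m m1; rewrite Rminus_0_r; apply: Rle_lt_trans; exact: Rle_abs.
have := hN3 _ (leq_trans m3 (hchi m)); have := hN4 _ (leq_trans m4 (hchi m)).
case: k3 => [/(_ (y, s) (conj hy hs)) /=|]; lra.
Qed.

(** * Radial test functions *)

Definition sqdist {n} (x0 y : vec n) : R := vdot (vsub y x0) (vsub y x0).

Lemma sqdistE n (x0 y : vec n) : sqdist x0 y = vdist y x0 ^ 2.
Proof. by rewrite /sqdist -vnorm_sqr /vdist; ring. Qed.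

Lemma sqdist_line n (x0 y : vec n) t k :
  sqdist x0 (vadd y (vscal t (ebasis k))) = sqdist x0 y + 2 * t * vsub y x0 k + t ^ 2.
Proof.
rewrite /sqdist.
have -> : vsub (vadd y (vscal t (ebasis k))) x0 = vadd (vsub y x0) (vscal t (ebasis k)).
  by apply: vecP => i; rewrite /vsub /vadd; ring.
have he z : vdot z (ebasis k) = z k by rewrite /vdot /ebasis rsum_delta.
move: (vsub y x0) => z.
rewrite !(vdotDl, vdotDr, vdotZl, vdotZr) (vdotC _ (ebasis k) z) !he.
by rewrite /ebasis eqxx; ring.
Qed.

Lemma cont_on_coord n (O : vset n) (x0 : vec n) k : cont_on O (fun y => vsub y x0 k).
Proof.
move=> x Ox eps e0; exists eps; split=> // y _ hy.
have -> : vsub y x0 k - vsub x x0 k = vsub y x k by rewrite /vsub; ring.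
exact: Rle_lt_trans (coord_le_vnorm _ _ _) hy.
Qed.

Lemma cont_on_const n (O : vset n) c : cont_on O (fun _ => c).
Proof. by move=> x _ eps e0; exists 1; split=> [|y _ _]; rewrite ?Rminus_diag ?Rabs_R0; lra. Qed.

Lemma cont_on_plus n (O : vset n) f g :
  cont_on O f -> cont_on O g -> cont_on O (fun y => f y + g y).
Proof.
move=> hf hg x Ox eps e0.
have e2 : 0 < eps / 2 by lra.
have [d [d0 hd]] := hf x Ox _ e2; have [d' [d'0 hd']] := hg x Ox _ e2.
exists (Rmin d d'); split=> [|y Oy hy]; first exact: Rmin_pos.
have h1 := hd y Oy (Rlt_le_trans _ _ _ hy (Rmin_l _ _)).
have h2 := hd' y Oy (Rlt_le_trans _ _ _ hy (Rmin_r _ _)).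
have -> : f y + g y - (f x + g x) = (f y - f x) + (g y - g x) by ring.
have := Rabs_triang (f y - f x) (g y - g x); lra.
Qed.

Lemma cont_on_mult n (O : vset n) f g :
  cont_on O f -> cont_on O g -> cont_on O (fun y => f y * g y).
Proof.
move=> hf hg x Ox eps e0.
pose K := Rabs (f x) + Rabs (g x) + 1.
have K1 : 1 <= K by rewrite /K; have := Rabs_pos (f x); have := Rabs_pos (g x); lra.
have e2 : 0 < Rmin 1 (eps / (2 * K)) by apply: Rmin_pos; [lra|apply: Rdiv_lt_0_compat; lra].
have [d [d0 hd]] := hf x Ox _ e2; have [d' [d'0 hd']] := hg x Ox _ e2.
exists (Rmin d d'); split=> [|y Oy hy]; first exact: Rmin_pos.
have h1 := hd y Oy (Rlt_le_trans _ _ _ hy (Rmin_l _ _)).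
have h2 := hd' y Oy (Rlt_le_trans _ _ _ hy (Rmin_r _ _)).
have -> : f y * g y - f x * g x = (f y - f x) * (g y - g x) + (f x * (g y - g x) + g x * (f y - f x)) by ring.
have := Rabs_triang ((f y - f x) * (g y - g x)) (f x * (g y - g x) + g x * (f y - f x)).
have := Rabs_triang (f x * (g y - g x)) (g x * (f y - f x)).
rewrite !Rabs_mult.
set a := Rabs (f y - f x) in h1 *; set b := Rabs (g y - g x) in h2 *.
have a0 : 0 <= a by exact: Rabs_pos.
have b0 : 0 <= b by exact: Rabs_pos.
have m1 := Rmin_l 1 (eps / (2 * K)); have m2 := Rmin_r 1 (eps / (2 * K)).
have hE : K * (eps / (2 * K)) = eps / 2 by field; lra.
set e := eps / (2 * K) in h1 h2 m1 m2 hE.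
have f0 := Rabs_pos (f x); have g0 := Rabs_pos (g x).
have p1 : a * b <= 1 * e by apply: Rmult_le_compat; lra.
have p2 : Rabs (f x) * b <= Rabs (f x) * e by apply: Rmult_le_compat_l; lra.
have p3 : Rabs (g x) * a <= Rabs (g x) * e by apply: Rmult_le_compat_l; lra.
have : K * e = Rabs (f x) * e + Rabs (g x) * e + e by rewrite /K; ring.
lra.
Qed.

(** On the sphere where [sqdist x0 y = c], the two parameters [B] and [D] allow the first and second
    radial derivatives to be prescribed independently. *)
Lemma radial_quartic_C2 n (O : vset n) (x0 : vec n) c B D :
  C2_with O (fun y => B * (sqdist x0 y - c) + D * (sqdist x0 y - c) ^ 2)
    (fun y k => (2 * B + 4 * D * (sqdist x0 y - c)) * vsub y x0 k)
    (fun y k l => 8 * D * vsub y x0 k * vsub y x0 l +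
       (2 * B + 4 * D * (sqdist x0 y - c)) * (if l == k then 1 else 0)).
Proof.
have hq : cont_on O (fun y => sqdist x0 y).
  have hp y : O y -> forall k, has_partial (fun y => sqdist x0 y) k y (2 * vsub y x0 k).
    move=> _ k; rewrite /has_partial -is_derive_Reals.
    apply: (is_derive_ext (fun t => sqdist x0 y + 2 * t * vsub y x0 k + t ^ 2)).
      by move=> t; rewrite sqdist_line.
    by auto_derive => //; ring.
  move=> x Ox eps e0.
  pose s := vdist x x0; have s0 : 0 <= s by exact: vdist_ge0.
  have e2 : 0 < Rmin 1 (eps / (2 * s + 1)) by apply: Rmin_pos; [lra|apply: Rdiv_lt_0_compat; lra].
  exists (Rmin 1 (eps / (2 * s + 1))); split=> // y _ hy.
  have m1 := Rmin_l 1 (eps / (2 * s + 1)); have m2 := Rmin_r 1 (eps / (2 * s + 1)).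
  rewrite !sqdistE -/s.
  have := vdist_lipschitz _ x0 y x; rewrite -/s; set t := vdist y x0 => hl.
  have t0 : 0 <= t by exact: vdist_ge0.
  have -> : t ^ 2 - s ^ 2 = (t - s) * (t + s) by ring.
  rewrite Rabs_mult (Rabs_right (t + s)); last lra.
  have h1 : t + s <= 2 * s + 1 by have := Rle_abs (t - s); lra.
  have hE : eps / (2 * s + 1) * (2 * s + 1) = eps by field; lra.
  have := Rabs_pos (t - s) => h2.
  have h3 : Rabs (t - s) < eps / (2 * s + 1) by lra.
  apply: Rle_lt_trans (_ : Rabs (t - s) * (2 * s + 1) < _).
    by apply: Rmult_le_compat_l.
  by rewrite -hE; apply: Rmult_lt_compat_r; lra.
split; last split.
- move=> y _ k; rewrite /has_partial -is_derive_Reals.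
  apply: (is_derive_ext (fun t => B * (sqdist x0 y + 2 * t * vsub y x0 k + t ^ 2 - c) +
     D * (sqdist x0 y + 2 * t * vsub y x0 k + t ^ 2 - c) ^ 2)).
    by move=> t; rewrite sqdist_line.
  by auto_derive => //; ring.
- move=> y _ k l; rewrite /has_partial -is_derive_Reals.
  apply: (is_derive_ext (fun t => (2 * B + 4 * D * (sqdist x0 y + 2 * t * vsub y x0 l + t ^ 2 - c)) *
      (vsub y x0 k + t * (if l == k then 1 else 0)))).
    move=> t; rewrite sqdist_line; congr (_ * _).
    by rewrite /vsub /vadd /vscal /ebasis eq_sym; ring.
  by auto_derive => //; ring.
- move=> k l.
  apply: (cont_on_plus _ _ (fun y => 8 * D * vsub y x0 k * vsub y x0 l)
    (fun y => (2 * B + 4 * D * (sqdist x0 y - c)) * (if l == k then 1 else 0))).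
    apply: (cont_on_mult _ _ (fun y => 8 * D * vsub y x0 k) (fun y => vsub y x0 l));
      last exact: cont_on_coord.
    exact: (cont_on_mult _ _ (fun _ => 8 * D) _ (cont_on_const _ _ _) (cont_on_coord _ _ _ _)).
  apply: (cont_on_mult _ _ (fun y => 2 * B + 4 * D * (sqdist x0 y - c))); last exact: cont_on_const.
  apply: (cont_on_plus _ _ (fun _ => 2 * B)); first exact: cont_on_const.
  apply: (cont_on_mult _ _ (fun _ => 4 * D)); first exact: cont_on_const.
  exact: (cont_on_plus _ _ (fun y => sqdist x0 y) (fun _ => - c) hq (cont_on_const _ _ _)).
Qed.

Lemma inflap_quad n (p : vec n) H : inflap p H = quad H p / vnorm p ^ 2.
Proof.
rewrite /inflap /quad Rmult_comm; congr (_ * _).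
by apply: eq_bigr => k _; apply: eq_bigr => l _; ring.
Qed.

Lemma quad_rank_one n (e : vec n) a D v :
  quad (fun k l => 8 * D * e k * e l + a * (if l == k then 1 else 0)) v =
  8 * D * vdot e v ^ 2 + a * vdot v v.
Proof.
rewrite quad_bil /bil.
have -> : (fun k => vdot (fun l => 8 * D * e k * e l + a * (if l == k then 1 else 0)) v)
   = vadd (vscal (8 * D * vdot e v) e) (vscal a v).
  apply: vecP => k; rewrite /vadd /vscal {1}/vdot.
  rewrite (eq_bigr (fun l => (8 * D * e k) * (e l * v l) + a * (v l * (if l == k then 1 else 0)))).
    by rewrite rsumD !rsumZ rsum_delta -/(vdot e v); ring.
  by move=> l _; ring.
by rewrite vdotDr !vdotZr (vdotC _ v e); ring.
Qed.

(** For [a <> 0] the gradient points along [e], and only the second derivative in that direction is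
    seen. For [a = 0] the Hessian is [8 D] times the rank-one matrix of [e]; when [D >= 0] its
    maximum over unit vectors is attained at [e / vnorm e]. With [D < 0] that maximum would be [0]
    in dimension at least two, whence the sign condition. *)
Lemma inflap_plus_radial n (e : vec n) a D :
  0 < vnorm e -> (a <> 0 \/ 0 <= 8 * D * vnorm e ^ 2 + a) ->
  inflap_plus_is (fun k => a * e k)
    (fun k l => 8 * D * e k * e l + a * (if l == k then 1 else 0))
    (8 * D * vnorm e ^ 2 + a).
Proof.
move=> e0 hcase.
have see : vdot e e = vnorm e ^ 2 by rewrite -vnorm_sqr; ring.
have [az|an] := Req_dec a 0; [right|left].
  case: hcase => // hD; rewrite az Rplus_0_r in hD *.
  split; first by apply: vecP => k; rewrite /vzero; ring.
  split.
    exists (vscal (/ vnorm e) e); split.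
      rewrite vnormZ Rabs_right; first by field; lra.
      by apply/Rle_ge/Rlt_le/Rinv_0_lt_compat.
    by rewrite quad_rank_one vdotZr see; field; lra.
  move=> v hv; rewrite quad_rank_one Rmult_0_l Rplus_0_r.
  have D0 : 0 <= 8 * D.
    by apply: (Rmult_le_reg_r (vnorm e ^ 2)); [exact: pow_lt|lra].
  apply: Rmult_le_compat_l => //.
  have := cauchy_schwarz _ e v; rewrite hv Rmult_1_r => h.
  by apply: pow_maj_Rabs.
have hv : vnorm (fun k => a * e k) = Rabs a * vnorm e by rewrite -vnormZ.
split.
  move=> h; have : vnorm (fun k => a * e k) = 0 by rewrite h vnorm0.
  by rewrite hv; have := Rabs_pos_lt a an; nra.
rewrite inflap_quad quad_rank_one hv.
have -> : vdot e (fun k => a * e k) = a * vnorm e ^ 2 by rewrite -see -vdotZr.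
have -> : vdot (fun k => a * e k) (fun k => a * e k) = a * (a * vnorm e ^ 2).
  by rewrite -see -vdotZr -vdotZl.
rewrite (Rpow_mult_distr (Rabs a)) pow2_abs.
field; split=> //; lra.
Qed.

(* The 2-jet at [|x - x0|] of the radial profile is realized, up to an arbitrarily small error, by a polynomial in [|y - x0|^2], which is smooth also at the centre. *)
Lemma radial_sub_test n (O : vset n) ui uj x0 x (k dk : R -> R) tau X :
  @sub_test n O ui uj -> O x -> 0 < vdist x x0 ->
  (forall t, derivable_pt_lim k t (dk t)) ->
  derivable_pt_lim dk (vdist x x0 + tau) X ->
  loc_max_at O (fun y => ui y - k (vdist y x0 + tau)) x ->
  (dk (vdist x x0 + tau) <> 0 \/ 0 <= X) ->
  ui x - uj x <= X.
Proof.
move=> hsub Ox; set s := vdist x x0 => s0 hk hdk [d [d0 hd]] hcase.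
apply: Rnot_lt_le => hlt.
(* The level [L] lies midway between [X] and [ui x - uj x]: it still violates the test and leaves
   [del] for the errors in the touching property. *)
pose del := (ui x - uj x - X) / 2; have del0 : 0 < del by rewrite /del; lra.
pose L := X + del.
pose p := dk (s + tau).
(* As a function of [t = vdist y x0], the quartic has first derivative [2 B s = p] and second
   derivative [2 B + 8 D s^2 = L] at [t = s]. *)
pose B := p / (2 * s); pose D := (L - p / s) / (8 * s ^ 2).
have hC := @radial_quartic_C2 n O x0 (s ^ 2) B D.
have hs : vnorm (vsub x x0) = s by [].
have hD : 8 * D * vnorm (vsub x x0) ^ 2 + 2 * B = L.
  by rewrite hs /D /B; field; lra.
have := @hsub _ _ _ x hC Ox _ L; rewrite sqdistE -/s.
rewrite (_ : 2 * B + 4 * D * (s ^ 2 - s ^ 2) = 2 * B); last by ring.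
have hL : inflap_plus_is (fun k => 2 * B * vsub x x0 k) (fun k l => 8 * D * vsub x x0 k * vsub x x0 l
         + 2 * B * (if l == k then 1 else 0)) L.
  rewrite -{}hD; apply: inflap_plus_radial; first by rewrite hs.
  case: hcase => h; [left|right].
    rewrite /B (_ : 2 * (p / (2 * s)) = p / s); last by field; lra.
    by rewrite /Rdiv; apply: Rmult_integral_contrapositive_currified => //; apply: Rinv_neq_0_compat; lra.
  rewrite hs (_ : _ + _ = L); last by rewrite /D /B; field; lra.
  by rewrite /L; lra.
suff hmax : loc_max_at O (fun y => ui y - (B * (sqdist x0 y - s ^ 2) + D * (sqdist x0 y - s ^ 2) ^ 2)) x.
  by move=> /(_ hmax hL); rewrite /L /del; lra.
have del4 : 0 < del / 4 by lra.
have [d1 [d10 hd1]] := @taylor2_at k dk (s + tau) X hk hdk _ del4.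
(* [K] bounds [Rabs D * (t + 3 * s)] for [t <= s + 1], the factor by which [B + D (t + s)^2] can
   depart from its value [L / 2] at [t = s]. *)
pose K := Rabs D * (4 * s + 1) + 1.
have K1 : 1 <= K by rewrite /K; have := Rabs_pos D; nra.
pose r := Rmin (Rmin d d1) (Rmin 1 (del / (4 * K))).
have r0 : 0 < r.
  by apply: Rmin_pos; apply: Rmin_pos => //; [lra|apply: Rdiv_lt_0_compat; lra].
have rd : r <= d by apply: Rle_trans (Rmin_l _ _) (Rmin_l _ _).
have rd1 : r <= d1 by apply: Rle_trans (Rmin_l _ _) (Rmin_r _ _).
have r1 : r <= 1 by apply: Rle_trans (Rmin_r _ _) (Rmin_l _ _).
have rK : r <= del / (4 * K) by apply: Rle_trans (Rmin_r _ _) (Rmin_r _ _).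
exists r; split=> // y Oy hy.
have h1 := hd y Oy (Rlt_le_trans _ _ _ hy rd).
rewrite !sqdistE -/s.
have := vdist_lipschitz _ x0 y x; rewrite -/s in h1 *.
set t := vdist y x0 in h1 * => hts.
have := hd1 (t + tau); rewrite (_ : t + tau - (s + tau) = t - s); last by ring.
move=> /(_ (Rle_lt_trans _ _ _ hts (Rlt_le_trans _ _ _ hy rd1))).
move=> /Rabs_le_between [_]; rewrite -/p => h2.
suff : k (t + tau) - k (s + tau) <= B * (t ^ 2 - s ^ 2) + D * (t ^ 2 - s ^ 2) ^ 2.
  rewrite (_ : B * (s ^ 2 - s ^ 2) + _ = 0); [lra|ring].
have -> : B * (t ^ 2 - s ^ 2) + D * (t ^ 2 - s ^ 2) ^ 2 =
  p * (t - s) + (B + D * (t + s) ^ 2) * (t - s) ^ 2 by rewrite /B; field; lra.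
suff : (X / 2 + del / 4) <= B + D * (t + s) ^ 2.
  by have := pow2_ge_0 (t - s); nra.
have -> : B + D * (t + s) ^ 2 = L / 2 + D * ((t + s) ^ 2 - (2 * s) ^ 2).
  by rewrite /B /D; field; lra.
rewrite /L; suff : Rabs (D * ((t + s) ^ 2 - (2 * s) ^ 2)) <= del / 4.
  by move=> /Rabs_le_between; lra.
have -> : D * ((t + s) ^ 2 - (2 * s) ^ 2) = D * (t + 3 * s) * (t - s) by ring.
have t0 : 0 <= t by exact: vdist_ge0.
rewrite Rabs_mult (Rabs_mult D) (Rabs_right (t + 3 * s)); last lra.
have hts1 : t <= s + 1 by have := Rle_abs (t - s); lra.
have hE : K * (del / (4 * K)) = del / 4 by field; lra.
rewrite -hE; apply: Rmult_le_compat; try lra.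
- by apply: Rmult_le_pos; [exact: Rabs_pos|lra].
- exact: Rabs_pos.
- by rewrite /K; have := Rabs_pos D; nra.
Qed.

(** * From subsolutions to comparison with cones *)

Lemma continuous_abs (k dk : R -> R) t : (forall t, derivable_pt_lim k t (dk t)) ->
  forall eps, 0 < eps -> exists d, 0 < d /\ forall s, Rabs (s - t) < d -> Rabs (k s - k t) < eps.
Proof.
move=> hk eps e0.
have hc : continuity_pt k t by apply: derivable_continuous_pt; exists (dk t); exact: hk.
have [d [d0 hd]] := hc eps e0.
exists d; split=> // s hs.
have [->|ne] := Req_dec s t; first by rewrite Rminus_diag Rabs_R0.
by apply: hd; split; [split=> // h; apply: ne|exact: hs].
Qed.

Lemma shifted_profile_usc n (U : vset n) u x0 r rho (k dk : R -> R) :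
  cont_on U u -> (forall x, vdist x x0 <= r -> U x) ->
  (forall t, derivable_pt_lim k t (dk t)) ->
  forall x t, vdist x x0 <= r -> Rabs t <= rho -> forall eps, 0 < eps ->
    exists d, 0 < d /\ forall y s, vdist y x0 <= r -> Rabs s <= rho ->
      vdist y x < d -> Rabs (s - t) < d ->
      u y - k (vdist y x0 + s) < u x - k (vdist x x0 + t) + eps.
Proof.
move=> hu hU hk x t hx ht eps e0.
have e2 : 0 < eps / 2 by lra.
have [d [d0 hd]] := hu x (hU x hx) _ e2.
have [d' [d'0 hd']] := continuous_abs k dk (vdist x x0 + t) hk _ e2.
exists (Rmin d (d' / 2)); split; first by apply: Rmin_pos; lra.
move=> y s hy hs hyx hst.
have := hd y (hU y hy) (Rlt_le_trans _ _ _ hyx (Rmin_l _ _)).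
have : Rabs (k (vdist y x0 + s) - k (vdist x x0 + t)) < eps / 2.
  apply: hd'; have -> : vdist y x0 + s - (vdist x x0 + t) = (vdist y x0 - vdist x x0) + (s - t) by ring.
  apply: Rle_lt_trans (Rabs_triang _ _) _.
  by have := vdist_lipschitz _ x0 y x; have := Rmin_r d (d' / 2); lra.
by move=> /Rabs_def2 h1 /Rabs_def2; lra.
Qed.

(* At a maximum point over [x] and the shift [t], either the 2-jet of the profile is admissible for the subsolution test, or the profile has a strict local maximum, against the optimality of the shift. *)
Lemma shifted_profile_max n (U : vset n) ui uj x0 r rho (ki dki ddki kj : R -> R) x t :
  sub_test U ui uj -> (forall y, vdist y x0 <= r -> U y) -> 0 < rho ->
  (forall s, derivable_pt_lim ki s (dki s)) ->
  (forall s, derivable_pt_lim dki s (ddki s)) ->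
  (forall s, ddki s < ki s - kj s) ->
  0 < vdist x x0 < r -> Rabs t <= rho ->
  (forall y s, vdist y x0 <= r -> Rabs s <= rho ->
     ui y - ki (vdist y x0 + s) <= ui x - ki (vdist x x0 + t)) ->
  uj x - kj (vdist x x0 + t) <= ui x - ki (vdist x x0 + t) -> False.
Proof.
move=> hsub hU rho0 hk hdk hstr hx ht hmax hij.
have xr : vdist x x0 <= r by lra.
have := hstr (vdist x x0 + t).
have [hc|hc] := classic (dki (vdist x x0 + t) <> 0 \/ 0 <= ddki (vdist x x0 + t)).
  (* Strictness and [hij] give [ddki < ki - kj <= ui x - uj x], the opposite of what the subsolution
     test yields. *)
  suff : ui x - uj x <= ddki (vdist x x0 + t) by lra.
  apply: (radial_sub_test _ U ui uj x0 x ki dki t) => //; first exact: hU; first lra.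
  exists (r - vdist x x0); split=> [|y _ hy]; first lra.
  by apply: hmax => //; have := vdist_triangle _ x y x0; lra.
have p0 : dki (vdist x x0 + t) = 0 by apply: NNPP => h; apply: hc; left.
have X0 : ddki (vdist x x0 + t) < 0 by apply: Rnot_le_lt => h; apply: hc; right.
move=> _; set s := vdist x x0 + t in p0 X0 hmax.
(* With this tolerance the profile drops by at least [- ddki s / 4 * h^2] under a shift of size [h],
   so [ui - ki] would exceed its maximum. *)
have e0 : 0 < - ddki s / 4 by lra.
have [d [d0 hd]] := taylor2_at ki dki s (ddki s) hk (hdk s) _ e0.
pose h := Rmin (d / 2) rho.
have h0 : 0 < h by apply: Rmin_pos; lra.
have hd2 : h <= d / 2 by exact: Rmin_l.
have hrho : h <= rho by exact: Rmin_r.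
(* The shift is moved towards zero, so that it remains in the admissible interval. *)
have [h' [hh' ht']] : exists h', Rabs h' = h /\ Rabs (t + h') <= rho.
  move: ht => /Rabs_le_between ht.
  have [t0|t0] := Rle_lt_dec 0 t.
    by exists (- h); rewrite Rabs_Ropp Rabs_right; [split=> //; apply: Rabs_le|]; lra.
  by exists h; rewrite Rabs_right; [split=> //; apply: Rabs_le|]; lra.
have := hmax x (t + h') xr ht'; rewrite -Rplus_assoc -/s.
have := hd (s + h'); rewrite (_ : s + h' - s = h'); last by ring.
have hlt : Rabs h' < d by lra.
move=> /(_ hlt) /Rabs_le_between [_]; rewrite p0 -pow2_abs hh'.
have : 0 < h ^ 2 by apply: pow_lt.
nra.
Qed.

(** Both differences are maximized separately and the larger maximum is examined. It cannot lie at a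
    point with [0 < vdist x x0 < r] by [shifted_profile_max]. The centre is grouped with the sphere
    because distance to it is not smooth there. *)
Lemma strict_radial_comparison n (U : vset n) u1 u2 x0 r rho M (k1 dk1 ddk1 k2 dk2 ddk2 : R -> R) :
  cont_on U u1 -> cont_on U u2 -> sub_test U u1 u2 -> sub_test U u2 u1 ->
  0 < r -> (forall y, vdist y x0 <= r -> U y) -> 0 < rho ->
  (forall s, derivable_pt_lim k1 s (dk1 s)) ->
  (forall s, derivable_pt_lim dk1 s (ddk1 s)) ->
  (forall s, ddk1 s < k1 s - k2 s) ->
  (forall s, derivable_pt_lim k2 s (dk2 s)) ->
  (forall s, derivable_pt_lim dk2 s (ddk2 s)) ->
  (forall s, ddk2 s < k2 s - k1 s) ->
  (forall x t, vdist x x0 = r \/ x = x0 -> Rabs t <= rho ->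
    u1 x - k1 (vdist x x0 + t) <= M /\ u2 x - k2 (vdist x x0 + t) <= M) ->
  forall x t, vdist x x0 <= r -> Rabs t <= rho ->
    u1 x - k1 (vdist x x0 + t) <= M /\ u2 x - k2 (vdist x x0 + t) <= M.
Proof.
move=> c1 c2 s1 s2 r0 hU rho0 hk1 hdk1 hs1 hk2 hdk2 hs2 hb x t hx ht.
have hr : 0 <= r by lra.
have hrho : 0 <= rho by lra.
have [x1 [t1 [hx1 [ht1 hm1]]]] := usc_attains_max _ x0 r rho _ hr hrho
  (shifted_profile_usc _ U u1 x0 r rho k1 dk1 c1 hU hk1).
have [x2 [t2 [hx2 [ht2 hm2]]]] := usc_attains_max _ x0 r rho _ hr hrho
  (shifted_profile_usc _ U u2 x0 r rho k2 dk2 c2 hU hk2).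
have hcase y : vdist y x0 <= r -> (vdist y x0 = r \/ y = x0) \/ 0 < vdist y x0 < r.
  move=> hy; have [->|ne] := classic (y = x0); first by left; right.
  have [->|lt] := Req_dec (vdist y x0) r; first by left; left.
  right; have := vdist_ge0 _ y x0; suff : vdist y x0 <> 0 by lra.
  by move=> /vdist_eq0.
have key : u1 x1 - k1 (vdist x1 x0 + t1) <= M /\ u2 x2 - k2 (vdist x2 x0 + t2) <= M.
  have [le|lt] := Rle_lt_dec (u2 x2 - k2 (vdist x2 x0 + t2)) (u1 x1 - k1 (vdist x1 x0 + t1)).
    have [e|i] := hcase _ hx1; first by have [] := hb _ _ e ht1; lra.
    exfalso; apply: (shifted_profile_max _ U u1 u2 x0 r rho k1 dk1 ddk1 k2 x1 t1) => //.
    by have := hm2 _ _ hx1 ht1; lra.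
  have [e|i] := hcase _ hx2; first by have [] := hb _ _ e ht2; lra.
  exfalso; apply: (shifted_profile_max _ U u2 u1 x0 r rho k2 dk2 ddk2 k1 x2 t2) => //.
  by have := hm1 _ _ hx2 ht2; lra.
by have := hm1 _ _ hx ht; have := hm2 _ _ hx ht; lra.
Qed.

(** Both components are covered, the second with [- C1] and [- C2]. The [eps] term cancels in the
    difference of the two profiles but lowers each second derivative by [2 * eps], which produces
    strictness. *)
Definition cone_profile (C1 C2 a b eps r t : R) : R :=
  C1 * exp (sqrt 2 * t) + C2 * exp (- (sqrt 2 * t)) + a * t + b + eps * (r ^ 2 - t ^ 2).

Lemma cone_profile_derive C1 C2 a b eps r t :
  derivable_pt_lim (cone_profile C1 C2 a b eps r) t
    (sqrt 2 * (C1 * exp (sqrt 2 * t) - C2 * exp (- (sqrt 2 * t))) + a - 2 * eps * t).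
Proof. by rewrite -is_derive_Reals /cone_profile; auto_derive => //; ring. Qed.

Lemma cone_profile_derive2 C1 C2 a eps t :
  derivable_pt_lim (fun t => sqrt 2 * (C1 * exp (sqrt 2 * t) - C2 * exp (- (sqrt 2 * t))) + a - 2 * eps * t) t
    (2 * (C1 * exp (sqrt 2 * t) + C2 * exp (- (sqrt 2 * t))) - 2 * eps).
Proof.
rewrite -is_derive_Reals; auto_derive => //.
have h2 : sqrt 2 * sqrt 2 = 2 by apply: sqrt_sqrt; lra.
by move: (sqrt 2) h2 => w h2; ring [h2].
Qed.

Lemma visc_sub_cone_cmp n (U : vset n) u1 u2 :
  cont_on U u1 -> cont_on U u2 -> sub_test U u1 u2 -> sub_test U u2 u1 ->
  cone_cmp_above U u1 u2.
Proof.
move=> c1 c2 s1 s2 x0 r C1 C2 a b Ux0 r0 hU hb x hx.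
suff main eta : 0 < eta ->
    u1 x <= psi1 x0 C1 C2 a b x + eta /\ u2 x <= psi2 x0 C1 C2 a b x + eta.
  by split; apply: le_epsilon => eta /main [].
move=> eta0.
have rr : 0 < r ^ 2 by apply: pow_lt.
(* Half of [eta] pays for the term [eps * (r ^ 2 - t ^ 2)], the other half for the change of the
   profiles under small shifts at distances [0] and [r]. *)
pose eps := eta / (2 * r ^ 2).
have eps0 : 0 < eps by apply: Rdiv_lt_0_compat; lra.
have er : eps * r ^ 2 = eta / 2 by rewrite /eps; field; lra.
pose k1 := cone_profile C1 C2 a b eps r.
pose k2 := cone_profile (- C1) (- C2) a b eps r.
have e1 y : k1 (vdist y x0) = psi1 x0 C1 C2 a b y + eps * (r ^ 2 - vdist y x0 ^ 2) by [].
have e2 y : k2 (vdist y x0) = psi2 x0 C1 C2 a b y + eps * (r ^ 2 - vdist y x0 ^ 2).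
  by rewrite /k2 /cone_profile /psi2; ring.
have hrho k dk c : (forall t, derivable_pt_lim k t (dk t)) ->
    exists d, 0 < d /\ forall t, Rabs t <= d -> k c <= k (c + t) + eta / 2.
  move=> hk; have eta2 : 0 < eta / 2 by lra.
  have [d [d0 hd]] := continuous_abs k dk c hk _ eta2.
  exists (d / 2); split=> [|t ht]; first lra.
  have /hd : Rabs (c + t - c) < d by rewrite (_ : c + t - c = t); [lra|ring].
  by move=> /Rabs_def2; lra.
have hk1 := cone_profile_derive C1 C2 a b eps r.
have hk2 := cone_profile_derive (- C1) (- C2) a b eps r.
have [d1 [d10 h1]] := hrho k1 _ 0 hk1; have [d2 [d20 h2]] := hrho k1 _ r hk1.
have [d3 [d30 h3]] := hrho k2 _ 0 hk2; have [d4 [d40 h4]] := hrho k2 _ r hk2.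
pose rho := Rmin (Rmin d1 d2) (Rmin d3 d4).
have rho0 : 0 < rho by rewrite /rho; do 2!apply: Rmin_pos => //; apply: Rmin_pos.
have l1 : rho <= d1 := Rle_trans _ _ _ (Rmin_l _ _) (Rmin_l _ _).
have l2 : rho <= d2 := Rle_trans _ _ _ (Rmin_l _ _) (Rmin_r _ _).
have l3 : rho <= d3 := Rle_trans _ _ _ (Rmin_r _ _) (Rmin_l _ _).
have l4 : rho <= d4 := Rle_trans _ _ _ (Rmin_r _ _) (Rmin_r _ _).
have := strict_radial_comparison _ U u1 u2 x0 r rho (eta / 2) k1 _ _ k2 _ _ c1 c2 s1 s2 r0 hU rho0
  hk1 (cone_profile_derive2 C1 C2 a eps) _ hk2 (cone_profile_derive2 (- C1) (- C2) a eps).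
move=> /(_ ltac:(move=> s; rewrite /k1 /k2 /cone_profile; lra)).
move=> /(_ ltac:(move=> s; rewrite /k1 /k2 /cone_profile; lra)).
have hbd y t : vdist y x0 = r \/ y = x0 -> Rabs t <= rho ->
    u1 y - k1 (vdist y x0 + t) <= eta / 2 /\ u2 y - k2 (vdist y x0 + t) <= eta / 2.
  move=> hy ht; have [b1 b2] := hb y hy.
  have sq : 0 <= eps * (r ^ 2 - vdist y x0 ^ 2).
    case: hy => ->; first by rewrite Rminus_diag; lra.
    by rewrite vdistxx; apply: Rmult_le_pos; nra.
  have := e1 y; have := e2 y.
  case: hy => [->|yx]; first by have := h2 t; have := h4 t; lra.
  by rewrite (_ : vdist y x0 = 0); [have := h1 t; have := h3 t; lra|rewrite yx vdistxx].
move=> /(_ hbd x 0 hx); rewrite Rabs_R0 Rplus_0_r => /(_ (Rlt_le _ _ rho0)).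
rewrite e1 e2.
have : eps * (r ^ 2 - vdist x x0 ^ 2) <= eps * r ^ 2.
  by apply: Rmult_le_compat_l; [lra|have := pow2_ge_0 (vdist x x0); lra].
lra.
Qed.

(** * From comparison with cones to subsolutions *)

(** With [t = sqrt 2 * x] the quantity is [cosh (2 x) - 1 - 2 x^2 = 2 (sinh x ^ 2 - x ^ 2)], and
    [sinh x] is within [x ^ 2] of [x]. Only [1 + y <= exp y], at [x] and [- x], and
    [exp x * exp (- x) = 1] enter. *)
Lemma cosh_sqrt2_bound t : 0 <= t <= 1 / 2 ->
  Rabs ((exp (sqrt 2 * t) + exp (- (sqrt 2 * t))) / 2 - 1 - t ^ 2) <= 3 * t ^ 3.
Proof.
move=> [t0 t1]; pose x := t / sqrt 2.
have w1 : 1 <= sqrt 2 by rewrite -sqrt_1; apply: sqrt_le_1_alt; lra.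
have w2 : sqrt 2 * sqrt 2 = 2 by apply: sqrt_sqrt; lra.
have tx : t = sqrt 2 * x by rewrite /x; field; lra.
have x0 : 0 <= x by apply: Rdiv_le_0_compat; lra.
have xt : x <= t by rewrite tx; nra.
have x2 : t ^ 2 = 2 * x ^ 2.
  by rewrite {}tx; move: (sqrt 2) x w2 {xt x0 w1} => w x w2; ring [w2].
rewrite (_ : sqrt 2 * t = x + x); last first.
  by rewrite tx -Rmult_assoc w2; ring.
rewrite Ropp_plus_distr !exp_plus x2.
have h1 := exp_ineq1_le x; have h2 := exp_ineq1_le (- x).
have EF : exp x * exp (- x) = 1 by rewrite -exp_plus Rplus_opp_r exp_0.
move: h1 h2 EF; set E := exp x; set F := exp (- x) => h1 h2 EF.
have E1 : E * (1 - x) <= 1 by nra.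
have F1 : F * (1 + x) <= 1 by nra.
have EU : E <= 1 + x + 2 * x ^ 2 by nra.
have FU : F <= 1 - x + x ^ 2 by nra.
pose S := (E - F) / 2.
have SU : S <= x + x ^ 2 by rewrite /S; lra.
have SL : x - x ^ 2 <= S by rewrite /S; lra.
rewrite (_ : _ - _ = 2 * ((S - x) * (S + x))); last first.
  rewrite /S (_ : 1 = E * F); last by rewrite EF.
  by field.
rewrite !Rabs_mult (Rabs_right 2); last lra.
have a1 : Rabs (S - x) <= x ^ 2 by apply: Rabs_le; lra.
have a2 : Rabs (S + x) <= 3 * x by apply: Rabs_le; nra.
have : Rabs (S - x) * Rabs (S + x) <= x ^ 2 * (3 * x).
  by apply: Rmult_le_compat => //; exact: Rabs_pos.
have : 3 * t ^ 3 = 6 * x ^ 2 * t by rewrite (_ : t ^ 3 = t ^ 2 * t); [rewrite x2|]; ring.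
have : 6 * x ^ 2 * x <= 6 * x ^ 2 * t by apply: Rmult_le_compat_l => //; nra.
nra.
Qed.

(* The cone used is the one with [C1 = C2 = D' / 4] centred at [y] that takes the value [al] at [y] and [be] on the sphere. *)
Lemma cone_cmp_discrete n (U : vset n) u1 u2 x D' sg C kap :
  vopen U -> U x -> cont_on U u2 -> cone_cmp_above U u1 u2 ->
  D' < u1 x - u2 x -> 0 < sg < 1 -> 0 < kap ->
  (forall del, 0 < del -> exists r y al be, 0 < r < del /\ vdist x y = sg * r /\
     u1 y <= al /\ (forall w, vdist w y = r -> u1 w <= be) /\
     Rabs (al - u1 x) <= C * r /\ Rabs (be - u1 x) <= C * r /\
     (1 - sg) * al + sg * be <= u1 x + D' / 2 * (sg * (1 - sg) * r ^ 2) - kap * r ^ 2) ->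
  False.
Proof.
move=> oU Ux c2 hc hD [sg0 sg1] kap0 hex.
have [R [R0 hR]] := oU x Ux.
(* The slack [eta] makes the second boundary inequality hold on small balls by continuity of [u2]
   alone, so only [u1] has to be controlled to second order. *)
pose eta := u1 x - u2 x - D'; have eta0 : 0 < eta by rewrite /eta; lra.
have eta2 : 0 < eta / 2 by lra.
have [d [d0 hd]] := c2 x Ux _ eta2.
have aD := Rabs_pos D'.
pose K := Rabs C + 3 * Rabs D' + 1.
have K1 : 1 <= K by rewrite /K; have := Rabs_pos C; lra.
pose del := Rmin (Rmin (R / 2) (d / 2)) (Rmin (1 / 2) (Rmin (eta / (2 * K)) (kap / K))).
have del0 : 0 < del.
  by rewrite /del; repeat apply: Rmin_pos; try lra; apply: Rdiv_lt_0_compat; lra.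
have [r [y [al [be [[r0 rdel] [hxy [hal [hbe [hal2 [hbe2 hmain]]]]]]]]]] := hex _ del0.
have [rR [rd [r1 [reta rkap]]]] :
    r < R / 2 /\ r < d / 2 /\ r < 1 / 2 /\ r < eta / (2 * K) /\ r < kap / K.
  move: rdel; rewrite /del => h.
  have := Rmin_l (Rmin (R / 2) (d / 2)) (Rmin (1 / 2) (Rmin (eta / (2 * K)) (kap / K))).
  have := Rmin_r (Rmin (R / 2) (d / 2)) (Rmin (1 / 2) (Rmin (eta / (2 * K)) (kap / K))).
  have := Rmin_l (R / 2) (d / 2); have := Rmin_r (R / 2) (d / 2).
  have := Rmin_l (1 / 2) (Rmin (eta / (2 * K)) (kap / K)).
  have := Rmin_r (1 / 2) (Rmin (eta / (2 * K)) (kap / K)).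
  have := Rmin_l (eta / (2 * K)) (kap / K); have := Rmin_r (eta / (2 * K)) (kap / K).
  by lra.
have {}reta : K * r < eta / 2.
  have := Rmult_lt_compat_l K _ _ ltac:(lra) reta.
  by rewrite (_ : K * (eta / (2 * K)) = eta / 2); [|field; lra].
have {}rkap : K * r < kap.
  have := Rmult_lt_compat_l K _ _ ltac:(lra) rkap.
  by rewrite (_ : K * (kap / K) = kap); [|field; lra].
pose s := sg * r.
have s0 : 0 < s by apply: Rmult_lt_0_compat.
have sr : s < r by rewrite /s; nra.
have near w : vdist w y <= r -> vdist w x < 2 * r.
  by move=> hw; have := vdist_triangle _ y w x; rewrite (vdist_sym _ y x) hxy -/s; lra.
have inU w : vdist w y <= r -> U w by move=> /near h; apply: hR; lra.
have hu2 w : vdist w y <= r -> u2 w < u2 x + eta / 2.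
  move=> hw; have /near h := hw; have := hd w (inU w hw).
  by move=> /(_ ltac:(lra)) /Rabs_def2; lra.
pose c t := (exp (sqrt 2 * t) + exp (- (sqrt 2 * t))) / 2 - 1.
have hcr : Rabs (c r - r ^ 2) <= 3 * r ^ 3 by apply: cosh_sqrt2_bound; lra.
have hcs : Rabs (c s - s ^ 2) <= 3 * s ^ 3 by apply: cosh_sqrt2_bound; lra.
pose a := (be - al - D' / 2 * c r) / r; pose b := al - D' / 2.
have p1 z t : vdist z y = t -> psi1 y (D' / 4) (D' / 4) a b z = D' / 2 * (1 + c t) + a * t + b.
  by move=> <-; rewrite /psi1 /c; field.
have p2 z t : vdist z y = t -> psi2 y (D' / 4) (D' / 4) a b z = - (D' / 2 * (1 + c t)) + a * t + b.
  by move=> <-; rewrite /psi2 /c; field.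
have c0 : c 0 = 0 by rewrite /c Rmult_0_r Ropp_0 exp_0; field.
have ar : a * r = be - al - D' / 2 * c r by rewrite /a; field; lra.
have as_ : a * s = sg * (be - al - D' / 2 * c r) by rewrite -ar /s; ring.
have Cr : C * r <= Rabs C * r by apply: Rmult_le_compat_r; [lra|exact: Rle_abs].
have r23 : r ^ 2 + 3 * r ^ 3 <= 3 * r by nra.
have Dcr : Rabs (D' * c r) <= 3 * Rabs D' * r.
  rewrite Rabs_mult; have : Rabs (c r) <= 3 * r.
    move: hcr => /Rabs_le_between hcr; apply: Rabs_le; split; last lra.
    by have := pow_lt r 2 r0; lra.
  by move=> h; rewrite (_ : 3 * _ * r = Rabs D' * (3 * r)); [apply: Rmult_le_compat_l|ring].
move: hal2 hbe2 => /Rabs_le_between hal2 /Rabs_le_between hbe2.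
have Kr : K * r = Rabs C * r + 3 * Rabs D' * r + r by rewrite /K; ring.
have Dr : 0 <= 3 * Rabs D' * r by apply: Rmult_le_pos; lra.
(* The second profile equals [al - D'] at [y] and [be - D' - D' * c r] on the sphere, both close to
   [u1 x - D' = u2 x + eta]. *)
have bd w : vdist w y = r \/ w = y ->
   u1 w <= psi1 y (D' / 4) (D' / 4) a b w /\ u2 w <= psi2 y (D' / 4) (D' / 4) a b w.
  case=> [hw|->].
    rewrite (p1 _ _ hw) (p2 _ _ hw) ar /b.
    have := hbe w hw; have := hu2 w (Req_le _ _ hw).
    move: Dcr => /Rabs_le_between; rewrite /eta in reta *; lra.
  rewrite (p1 _ _ (vdistxx _ y)) (p2 _ _ (vdistxx _ y)) c0 /b.
  have := hu2 y; rewrite vdistxx => /(_ (Rlt_le _ _ r0)); rewrite /eta in reta *; lra.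
have Uy : U y by apply: inU; rewrite vdistxx; lra.
have [] := hc y r (D' / 4) (D' / 4) a b Uy r0 inU bd x; first by rewrite hxy -/s; lra.
rewrite (p1 _ _ hxy) -/s as_ /b => hfin _.
have s3 : s ^ 3 <= r ^ 3 by apply: pow_incr; lra.
have rr := pow_lt r 2 r0.
have ss : s ^ 2 = sg * r ^ 2 - sg * (1 - sg) * r ^ 2 by rewrite /s; ring.
(* The first profile at [x] is [(1 - sg) al + sg be + D' / 2 * (c s - sg * c r)]. Replacing [c t] by
   [t ^ 2] turns the last bracket into [- sg (1 - sg) r^2]; [er] is the cubic error, which
   [kap * r ^ 2] outweighs. *)
pose er := (c s - s ^ 2) - sg * (c r - r ^ 2).
have her : Rabs er <= 6 * r ^ 3.
  move: hcr hcs => /Rabs_le_between hcr /Rabs_le_between hcs.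
  have r3 := pow_lt r 3 r0.
  by apply: Rabs_le; rewrite /er; nra.
have : D' / 2 * er <= Rabs D' / 2 * (6 * r ^ 3).
  apply: Rle_trans (Rle_abs _) _; rewrite Rabs_mult.
  have -> : Rabs (D' / 2) = Rabs D' / 2 by rewrite Rabs_div; [rewrite (Rabs_right 2)|]; lra.
  by apply: Rmult_le_compat_l; lra.
have : Rabs D' / 2 * (6 * r ^ 3) <= K * r * r ^ 2.
  have : 0 <= Rabs C * r by apply: Rmult_le_pos; [exact: Rabs_pos|lra].
  by rewrite (_ : Rabs D' / 2 * _ = 3 * Rabs D' * r * r ^ 2); [move=> ?; apply: Rmult_le_compat_r; lra|field].
have : K * r * r ^ 2 < kap * r ^ 2 by apply: Rmult_lt_compat_r.
rewrite /er ss; lra.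
Qed.

Lemma touching_expansion n (U : vset n) u phi Dphi D2phi x :
  vopen U -> @C2_with n U phi Dphi D2phi -> U x -> loc_max_at U (fun y => u y - phi y) x ->
  forall eps, 0 < eps -> exists d, 0 < d /\ forall h, vnorm h < d ->
    u (vadd x h) <= u x + vdot (Dphi x) h + quad (D2phi x) h / 2 + eps * vnorm h ^ 2.
Proof.
move=> oU hC Ux [d [d0 hd]] eps e0.
have [r [r0 hr]] := oU x Ux.
have [d' [d'0 hd']] := second_order_expansion _ U phi Dphi D2phi x oU hC Ux eps e0.
exists (Rmin (Rmin d r) d'); split=> [|h hh]; first by do 2!apply: Rmin_pos => //.
have h1 : vnorm h < d by apply: Rlt_le_trans hh _; apply: Rle_trans (Rmin_l _ _) (Rmin_l _ _).
have h2 : vnorm h < r by apply: Rlt_le_trans hh _; apply: Rle_trans (Rmin_l _ _) (Rmin_r _ _).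
have h3 : vnorm h < d' by apply: Rlt_le_trans hh (Rmin_r _ _).
have Oh : U (vadd x h) by apply: hr; rewrite vdist_add.
have := hd _ Oh; rewrite vdist_add => /(_ h1).
by have := hd' _ h3 => /Rabs_le_between; lra.
Qed.

Lemma vdist_sphere n (w x e : vec n) s :
  vdist w (vadd x (vscal (- s) e)) = vnorm (vadd (vsub w x) (vscal s e)).
Proof. by congr vnorm; apply: vecP => i; rewrite /vsub /vadd /vscal; ring. Qed.

Lemma quad_le_of_unit n (H : 'I_n -> 'I_n -> R) L : (forall v, vnorm v = 1 -> quad H v <= L) ->
  forall h, quad H h <= L * vnorm h ^ 2.
Proof.
move=> hL h; have [h0|h0] := Req_dec (vnorm h) 0.
  rewrite h0 (vnorm_eq0 _ _ h0) quad_bil /bil /vdot big1; first by lra.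
  by move=> i _; rewrite /vzero; ring.
have hp : 0 < vnorm h by have := vnorm_ge0 _ h; lra.
have : quad H (vscal (/ vnorm h) h) <= L.
  apply: hL; rewrite vnormZ Rabs_right; first by field.
  exact/Rle_ge/Rlt_le/Rinv_0_lt_compat.
rewrite !quad_bil bilZl bilZr => hq.
have := Rmult_le_compat_r (vnorm h ^ 2) _ _ (pow2_ge_0 _) hq.
by rewrite (_ : _ * _ * vnorm h ^ 2 = bil H h h); last by field.
Qed.

(* Along the gradient direction [e], the second-order term on the sphere of radius [2 s] about [x - s e] is governed by [quad H e]: the first-order loss [P |v|^2 / (4 s)] absorbs the transversal part [v]. *)
Lemma sphere_expansion_bound n (H : 'I_n -> 'I_n -> R) (e h : vec n) K P s eps :
  0 <= K -> (forall x y, Rabs (bil H x y) <= K * (vnorm x * vnorm y)) ->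
  vnorm e = 1 -> 0 < P -> 0 < s -> 9 * K ^ 2 * s <= eps * P ->
  vnorm (vadd h (vscal s e)) = 2 * s ->
  P * vdot e h + quad H h / 2 <= s * P + s ^ 2 * quad H e / 2 + eps * s ^ 2.
Proof.
move=> K0 hK he P0 s0 hs hn.
(* [v] is the displacement from the point [x + s e] of the sphere farthest in direction [e].
   Expanding [vnorm (2 s e + v) = 2 s] gives [ev]. *)
pose v := vadd h (vscal (- s) e).
have hv : h = vadd (vscal s e) v.
  by apply: vecP => i; rewrite /v /vadd /vscal; ring.
have ee : vdot e e = 1 by rewrite -vnorm_sqr he; ring.
have ev : 4 * s * vdot e v = - vnorm v ^ 2.
  have := vnorm_sqr _ (vadd h (vscal s e)); rewrite hn hv.
  have -> : vadd (vadd (vscal s e) v) (vscal s e) = vadd (vscal (2 * s) e) v.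
    by apply: vecP => i; rewrite /vadd /vscal; ring.
  move: (v) => z; rewrite !(vdotDl, vdotDr, vdotZl, vdotZr) ee (vdotC _ z e) -vnorm_sqr; lra.
have vs : vnorm v <= 4 * s.
  have -> : v = vadd (vadd h (vscal s e)) (vscal (- (2 * s)) e).
    by apply: vecP => i; rewrite /v /vadd /vscal; ring.
  apply: Rle_trans (vnorm_triangle _ _ _) _.
  by rewrite hn vnormZ he Rabs_Ropp Rabs_right; lra.
have -> : vdot e h = s + vdot e v by rewrite hv; move: (v) => z; rewrite vdotDr vdotZr ee; ring.
have -> : quad H h = s ^ 2 * quad H e + s * (bil H e v + bil H v e) + bil H v v.
  rewrite hv !quad_bil; move: (v) => z; rewrite !(bilDl, bilDr, bilZl, bilZr); ring.
have := hK e v; have := hK v e; have := hK v v; rewrite he.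
have := vnorm_ge0 _ v; move: ev vs; set m := vnorm v => ev vs m0.
move=> /Rabs_le_between [_ b1] /Rabs_le_between [_ b2] /Rabs_le_between [_ b3].
have b4 : K * (m * m) <= K * m * (4 * s).
  by rewrite -Rmult_assoc; apply: Rmult_le_compat_l => //; apply: Rmult_le_pos.
have b5 : s * (bil H e v + bil H v e) <= s * (2 * (K * m)) by apply: Rmult_le_compat_l; lra.
suff : 3 * s * K * m <= eps * s ^ 2 - P * vdot e v by lra.
have -> : vdot e v = - m ^ 2 / (4 * s) by rewrite -ev; field; lra.
have : 9 * K ^ 2 * s ^ 3 / P <= eps * s ^ 2.
  apply: (Rmult_le_reg_r P) => //.
  have -> : 9 * K ^ 2 * s ^ 3 / P * P = 9 * K ^ 2 * s * s ^ 2 by field; lra.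
  have -> : eps * s ^ 2 * P = eps * P * s ^ 2 by ring.
  by apply: Rmult_le_compat_r => //; apply: pow2_ge_0.
(* Completing the square in [m] bounds the mixed terms; the remainder [9 K^2 s^3 / P] is what the
   smallness hypothesis on [s] controls. *)
have : 0 <= P / (4 * s) * (m - 6 * s ^ 2 * K / P) ^ 2.
  apply: Rmult_le_pos; last exact: pow2_ge_0.
  by apply/Rlt_le/Rdiv_lt_0_compat; lra.
have -> : P / (4 * s) * (m - 6 * s ^ 2 * K / P) ^ 2 =
   P * (m ^ 2 / (4 * s)) - 3 * s * K * m + 9 * K ^ 2 * s ^ 3 / P by field; lra.
have -> : P * (- m ^ 2 / (4 * s)) = - (P * (m ^ 2 / (4 * s))) by field; lra.
lra.
Qed.

Lemma cone_cmp_sub_test n (U : vset n) u1 u2 :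
  vopen U -> cont_on U u2 -> cone_cmp_above U u1 u2 -> sub_test U u1 u2.
Proof.
move=> oU c2 hc phi Dphi D2phi x hC Ux hmax L hL.
apply: Rnot_lt_le => hlt.
have hexp := touching_expansion _ U u1 phi Dphi D2phi x oU hC Ux hmax.
pose D' := (L + (u1 x - u2 x)) / 2.
have D'D : D' < u1 x - u2 x by rewrite /D'; lra.
have LD' : L < D' by rewrite /D'; lra.
clearbody D'.
move: (Dphi x) (D2phi x) hL hexp => p H hL hexp.
have aL := Rabs_pos L; have aL1 := Rle_abs L; have aL2 := Rle_abs (- L).
rewrite Rabs_Ropp in aL2.
case: hL => [[pn0 hL]|[p0 [[e [he _]] hL]]].
- pose P := vnorm p.
  have P0 : 0 < P.
    have [//|h] := Rle_lt_or_eq_dec _ _ (vnorm_ge0 _ p).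
    by case: pn0; apply: vnorm_eq0.
  pose e := vscal (/ P) p.
  have he : vnorm e = 1.
    rewrite /e vnormZ Rabs_right; first by rewrite -/P; field; lra.
    exact/Rle_ge/Rlt_le/Rinv_0_lt_compat.
  have pe : p = vscal P e by apply: vecP => i; rewrite /e /vscal; field; lra.
  have hLe : quad H e = L.
    by rewrite hL inflap_quad !quad_bil /e bilZl bilZr -/P; field; lra.
  have [K [K0 hK]] := bil_bounded _ H.
  (* With [r = 2 s], [sg = 1 / 2] and [kap = eps / 8], the errors in the averaged inequality add up
     to [6 eps s^2], exactly [(D' - L) / 2 * s ^ 2]. *)
  pose eps := (D' - L) / 12.
  have eps0 : 0 < eps by rewrite /eps; lra.
  have [d [d0 hd]] := hexp eps eps0.
  apply: (cone_cmp_discrete _ U u1 u2 x D' (1 / 2) (P + Rabs L + 10 * eps) (eps / 8)) => //; [lra|lra|].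
  move=> del del0.
  pose s := Rmin (Rmin (del / 4) (d / 4)) (Rmin (1 / 2) (eps * P / (9 * K ^ 2 + 1))).
  have K2 := pow2_ge_0 K.
  have s0 : 0 < s.
    rewrite /s; apply: Rmin_pos; apply: Rmin_pos; try lra.
    by apply: Rdiv_lt_0_compat; [apply: Rmult_lt_0_compat|lra].
  have [s1 [s2 [s3 s4]]] : s <= del / 4 /\ s <= d / 4 /\ s <= 1 / 2 /\ s <= eps * P / (9 * K ^ 2 + 1).
    rewrite /s; have := Rmin_l (Rmin (del / 4) (d / 4)) (Rmin (1 / 2) (eps * P / (9 * K ^ 2 + 1))).
    have := Rmin_r (Rmin (del / 4) (d / 4)) (Rmin (1 / 2) (eps * P / (9 * K ^ 2 + 1))).
    have := Rmin_l (del / 4) (d / 4); have := Rmin_r (del / 4) (d / 4).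
    have := Rmin_l (1 / 2) (eps * P / (9 * K ^ 2 + 1)).
    have := Rmin_r (1 / 2) (eps * P / (9 * K ^ 2 + 1)); lra.
  clearbody s.
  have {}s4 : 9 * K ^ 2 * s <= eps * P.
    have := Rmult_le_compat_r (9 * K ^ 2 + 1) _ _ ltac:(lra) s4.
    rewrite (_ : _ / _ * _ = eps * P); last by field; lra.
    lra.
  have ss : 0 < s ^ 2 by apply: pow_lt.
  have ssl : s ^ 2 <= s by nra.
  (* [al] is the expansion at [h = - s e]. In [be], one [eps] comes from [sphere_expansion_bound]
     and nine from [vnorm h <= 3 s]. *)
  exists (2 * s), (vadd x (vscal (- s) e)), (u1 x - s * P + s ^ 2 * L / 2 + eps * s ^ 2),
    (u1 x + s * P + s ^ 2 * L / 2 + 10 * eps * s ^ 2).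
  have se : vnorm (vscal (- s) e) = s by rewrite vnormZ he Rabs_Ropp Rabs_right; lra.
  have sL : Rabs (s ^ 2 * L) <= s * Rabs L.
    by rewrite Rabs_mult (Rabs_right (s ^ 2)); [apply: Rmult_le_compat_r|lra].
  move: sL => /Rabs_le_between sL.
  have se2 : eps * s ^ 2 <= eps * s by apply: Rmult_le_compat_l; lra.
  have se3 : 0 < eps * s ^ 2 by apply: Rmult_lt_0_compat.
  have sP : 0 < s * P by apply: Rmult_lt_0_compat.
  have sLp : 0 <= s * Rabs L by apply: Rmult_le_pos; lra.
  split; first lra.
  split; first by rewrite vdist_sym vdist_add se; lra.
  split.
    have := hd (vscal (- s) e); rewrite se => /(_ ltac:(lra)).
    rewrite quad_bil bilZl bilZr -quad_bil hLe vdotZr {1}pe vdotZl -vnorm_sqr he.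
    by lra.
  split.
    move=> w hw; rewrite vdist_sphere in hw.
    have hb := sphere_expansion_bound _ H e (vsub w x) K P s eps K0 hK he P0 s0 s4 hw.
    have h3 : vnorm (vsub w x) <= 3 * s.
      have -> : vsub w x = vadd (vadd (vsub w x) (vscal s e)) (vscal (- s) e).
        by apply: vecP => i; rewrite /vadd /vscal; ring.
      by apply: Rle_trans (vnorm_triangle _ _ _) _; rewrite hw se; lra.
    have := hd (vsub w x) ltac:(lra); rewrite vadd_sub {1}pe vdotZl.
    rewrite hLe in hb.
    have : eps * vnorm (vsub w x) ^ 2 <= eps * (3 * s) ^ 2.
      by apply: Rmult_le_compat_l; [lra|apply: pow_incr; split=> //; exact: vnorm_ge0].
    lra.
  split; first by apply: Rabs_le; lra.
  split; first by apply: Rabs_le; lra.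
  have : D' * s ^ 2 - L * s ^ 2 = 12 * eps * s ^ 2 by rewrite /eps; field.
  lra.
- have hq := quad_le_of_unit _ H L hL.
  pose g := D' - L; have g0 : 0 < g by rewrite /g; lra.
  pose eps := g / 40; have eps0 : 0 < eps by rewrite /eps; lra.
  have [d [d0 hd]] := hexp eps eps0.
  have aD := Rabs_pos D'; have aD1 := Rle_abs D'; have aD2 := Rle_abs (- D').
  rewrite Rabs_Ropp in aD2.
  (* [M] dominates the coefficients of [sg] in [key]: these errors cost at most [g / 8], the [eps]
     terms [5 eps = g / 8], within the [3 g / 8] left after the margin [kap]. *)
  pose M := 2 * Rabs L + Rabs D' + 1.
  pose sg := Rmin (1 / 2) (g / (8 * M)).
  have M1 : 1 <= M by rewrite /M; lra.
  have sg0 : 0 < sg by apply: Rmin_pos; [lra|apply: Rdiv_lt_0_compat; lra].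
  have sg1 : sg <= 1 / 2 by exact: Rmin_l.
  have sgM : sg * M <= g / 8.
    have : sg <= g / (8 * M) by exact: Rmin_r.
    move=> /(Rmult_le_compat_r M _ _ ltac:(lra)).
    by rewrite (_ : g / (8 * M) * M = g / 8); [|field; lra].
  clearbody sg.
  apply: (cone_cmp_discrete _ U u1 u2 x D' sg (3 * Rabs L + 5 * eps) (sg * (g / 8))) => //.
  + lra.
  + by apply: Rmult_lt_0_compat; lra.
  move=> del del0.
  pose r := Rmin (del / 2) (Rmin (d / 4) 1).
  have r0 : 0 < r by rewrite /r; apply: Rmin_pos; last apply: Rmin_pos; lra.
  have [r1 [r2 r3]] : r <= del / 2 /\ r <= d / 4 /\ r <= 1.
    rewrite /r; have := Rmin_l (del / 2) (Rmin (d / 4) 1); have := Rmin_r (del / 2) (Rmin (d / 4) 1).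
    have := Rmin_l (d / 4) 1; have := Rmin_r (d / 4) 1; lra.
  clearbody r.
  have rr : 0 < r ^ 2 by apply: pow_lt.
  have rrl : r ^ 2 <= r by nra.
  pose s := sg * r.
  have s0 : 0 < s by apply: Rmult_lt_0_compat.
  have sr : s <= r / 2 by rewrite /s; nra.
  have ssr : s ^ 2 = sg ^ 2 * r ^ 2 by rewrite /s; ring.
  have p0h h : vdot p h = 0.
    by rewrite p0 /vdot big1 // => i _; rewrite /vzero; ring.
  (* Here [quad H h <= L * vnorm h ^ 2]. On the sphere [vnorm h] lies between [r - s] and [r + s],
     so its square differs from [r ^ 2] by at most [3 sg r^2] and is at most [4 r^2]. *)
  exists r, (vadd x (vscal (- s) e)), (u1 x + (L / 2 + eps) * s ^ 2),
    (u1 x + (L / 2 + 3 / 2 * Rabs L * sg + 4 * eps) * r ^ 2).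
  have se : vnorm (vscal (- s) e) = s by rewrite vnormZ he Rabs_Ropp Rabs_right; lra.
  split; first lra.
  split; first by rewrite vdist_sym vdist_add se.
  split.
    have := hd (vscal (- s) e); rewrite se p0h => /(_ ltac:(lra)).
    by have := hq (vscal (- s) e); rewrite se; lra.
  split.
    move=> w hw; rewrite vdist_sphere in hw.
    set h := vsub w x in hw *.
    have hU : vnorm h <= r + s.
      have -> : h = vadd (vadd h (vscal s e)) (vscal (- s) e).
        by apply: vecP => i; rewrite /vadd /vscal; ring.
      by apply: Rle_trans (vnorm_triangle _ _ _) _; rewrite hw se; lra.
    have hl : r - s <= vnorm h.
      have := vnorm_triangle _ h (vscal s e); rewrite hw vnormZ he Rabs_right; lra.
    have := hd h ltac:(lra); rewrite vadd_sub p0h; have := hq h.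
    have hh : Rabs (vnorm h ^ 2 - r ^ 2) <= 3 * sg * r ^ 2.
      have -> : 3 * sg * r ^ 2 = 3 * r * s by rewrite /s; ring.
      by apply: Rabs_le; nra.
    have : L * (vnorm h ^ 2 - r ^ 2) <= Rabs L * (3 * sg * r ^ 2).
      apply: Rle_trans (Rle_abs _) _; rewrite Rabs_mult.
      by apply: Rmult_le_compat_l.
    have : eps * vnorm h ^ 2 <= eps * (4 * r ^ 2) by apply: Rmult_le_compat_l; nra.
    lra.
  have sgL : 0 <= sg * Rabs L <= Rabs L / 2 by nra.
  have b1 : Rabs (L / 2 + eps) <= 3 * Rabs L + 5 * eps by apply: Rabs_le; lra.
  have b2 : Rabs (L / 2 + 3 / 2 * Rabs L * sg + 4 * eps) <= 3 * Rabs L + 5 * eps by apply: Rabs_le; lra.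
  have ssl : 0 <= s ^ 2 <= r by rewrite ssr; nra.
  split.
    rewrite (_ : _ - _ = (L / 2 + eps) * s ^ 2); last by ring.
    rewrite Rabs_mult (Rabs_right (s ^ 2)); last by lra.
    by apply: Rmult_le_compat; [exact: Rabs_pos|lra|lra|lra].
  split.
    rewrite (_ : _ - _ = (L / 2 + 3 / 2 * Rabs L * sg + 4 * eps) * r ^ 2); last by ring.
    rewrite Rabs_mult (Rabs_right (r ^ 2)); last by lra.
    by apply: Rmult_le_compat; [exact: Rabs_pos|lra|lra|lra].
  (* This is the required averaged inequality divided by [sg * r ^ 2]. *)
  have key : (1 - sg) * sg * (L / 2 + eps) + (L / 2 + 3 / 2 * Rabs L * sg + 4 * eps)
      <= D' / 2 * (1 - sg) - g / 8.
    have : (1 - sg) * sg * (L / 2 + eps) <= sg * Rabs L / 2 + eps.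
      have : 0 <= (1 - sg) * sg <= sg by nra.
      move: ((1 - sg) * sg) => q hq'.
      have : q * L <= sg * Rabs L by nra.
      nra.
    have : - (sg * Rabs D') <= - (D' * sg) by nra.
    move: sgM; rewrite /M => sgM.
    have : D' = g + L by rewrite /g; ring.
    have : eps = g / 40 by [].
    nra.
  have := Rmult_le_compat_r (sg * r ^ 2) _ _ _ key.
  move=> /(_ ltac:(by apply: Rmult_le_pos; lra)); rewrite ssr; lra.
Qed.

(** * The equivalence for subsolutions *)

Lemma cont_on_of_closure n (U : vset n) u : cont_on (vclosure U) u -> cont_on U u.
Proof.
have sub x : U x -> vclosure U x by move=> Ux r r0; exists x; rewrite vdistxx.
move=> hu x Ux eps e0; have [d [d0 hd]] := hu x (sub x Ux) eps e0.
by exists d; split=> // y Uy; apply: hd; apply: sub.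
Qed.

(** Changing the signs of [C1] and [C2] exchanges the two cones. *)
Lemma cone_cmp_above_sym n (U : vset n) u1 u2 : cone_cmp_above U u1 u2 -> cone_cmp_above U u2 u1.
Proof.
move=> hc x0 r C1 C2 a b Ux0 r0 hU hb x hx.
have e1 y : psi1 x0 (- C1) (- C2) a b y = psi2 x0 C1 C2 a b y by rewrite /psi1 /psi2; ring.
have e2 y : psi2 x0 (- C1) (- C2) a b y = psi1 x0 C1 C2 a b y by rewrite /psi1 /psi2; ring.
have := hc x0 r (- C1) (- C2) a b Ux0 r0 hU _ x hx; rewrite e1 e2 => h.
have [y hy|h1 h2] := h; last by [].
by rewrite e1 e2; have [] := hb y hy.
Qed.

Lemma visc_sub_iff_cone_cmp_above n (U : vset n) u1 u2 :
  vopen U -> cont_on U u1 -> cont_on U u2 ->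
  visc_sub U u1 u2 <-> cone_cmp_above U u1 u2.
Proof.
move=> oU c1 c2; split=> [[_ [_ [s1 s2]]]|hc]; first exact: visc_sub_cone_cmp.
have husc u : cont_on U u -> usc_on U u.
  move=> hu x Ux eps e0; have [d [d0 hd]] := hu x Ux eps e0.
  by exists d; split=> // y Uy hy; have := hd y Uy hy => /Rabs_def2; lra.
do 2!(split; first exact: husc).
by split; apply: cone_cmp_sub_test => //; exact: cone_cmp_above_sym.
Qed.

(** * Change of sign and supersolutions *)

Lemma C2_with_opp n (O : vset n) phi Dphi D2phi : @C2_with n O phi Dphi D2phi ->
  C2_with O (fun x => - phi x) (fun x k => - Dphi x k) (fun x k l => - D2phi x k l).
Proof.
move=> [h1 [h2 h3]]; split; [|split].
- by move=> x Ox k; apply: derivable_pt_lim_opp; exact: h1.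
- by move=> x Ox k l; apply: (derivable_pt_lim_opp _ _ _ (h2 x Ox k l)).
- move=> k l x Ox eps e0; have [d [d0 hd]] := h3 k l x Ox eps e0.
  exists d; split=> // y Oy hy.
  by rewrite (_ : _ - _ = - (D2phi y k l - D2phi x k l)); [rewrite Rabs_Ropp; exact: hd|ring].
Qed.

Lemma quad_opp n (H : 'I_n -> 'I_n -> R) v : quad (fun k l => - H k l) v = - quad H v.
Proof.
rewrite !quad_bil -[RHS]Rmult_1_l /bil.
have -> : (fun k => vdot (fun l => - H k l) v) = vscal (-1) (fun k => vdot (H k) v).
  apply: vecP => k; rewrite /vscal -vdotZl.
  by congr vdot; apply: vecP => l; rewrite /vscal; ring.
rewrite vdotZr; ring.
Qed.

Lemma inflap_minus_opp n (p : vec n) H L : inflap_minus_is p H L ->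
  inflap_plus_is (fun k => - p k) (fun k l => - H k l) (- L).
Proof.
have pE : (fun k => - p k) = vscal (-1) p by apply: vecP => k; rewrite /vscal; ring.
case=> [[pn ->]|[p0 [[v [v1 hv]] hmin]]]; [left|right].
  split.
    move=> h; apply: pn; apply: vecP => k.
    by have := congr1 (fun f => f k) h; rewrite /vzero; lra.
  rewrite !inflap_quad pE quad_opp vnormZ Rabs_Ropp Rabs_R1 Rmult_1_l !quad_bil bilZl bilZr.
  by rewrite /Rdiv; ring.
split; first by apply: vecP => k; rewrite p0 /vzero; ring.
split; first by exists v; rewrite quad_opp hv.
by move=> w /hmin; rewrite quad_opp; lra.
Qed.

Lemma inflap_plus_opp n (p : vec n) H L : inflap_plus_is p H L ->
  inflap_minus_is (fun k => - p k) (fun k l => - H k l) (- L).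
Proof.
have pE : (fun k => - p k) = vscal (-1) p by apply: vecP => k; rewrite /vscal; ring.
case=> [[pn ->]|[p0 [[v [v1 hv]] hmax]]]; [left|right].
  split.
    move=> h; apply: pn; apply: vecP => k.
    by have := congr1 (fun f => f k) h; rewrite /vzero; lra.
  rewrite !inflap_quad pE quad_opp vnormZ Rabs_Ropp Rabs_R1 Rmult_1_l !quad_bil bilZl bilZr.
  by rewrite /Rdiv; ring.
split; first by apply: vecP => k; rewrite p0 /vzero; ring.
split; first by exists v; rewrite quad_opp hv.
by move=> w /hmax; rewrite quad_opp; lra.
Qed.

Lemma super_test_opp n (U : vset n) ui uj :
  super_test U ui uj <-> sub_test U (fun x => - ui x) (fun x => - uj x).
Proof.
split=> h phi Dphi D2phi x hC Ux [r [r0 hr]] L hL.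
  have hext : loc_min_at U (fun y => ui y - - phi y) x.
    by exists r; split=> // y Uy hy; have := hr y Uy hy; lra.
  have := h _ _ _ x (C2_with_opp _ _ _ _ _ hC) Ux hext (- L) (inflap_plus_opp _ _ _ _ hL); lra.
have hext : loc_max_at U (fun y => - ui y - - phi y) x.
  by exists r; split=> // y Uy hy; have := hr y Uy hy; lra.
have := h _ _ _ x (C2_with_opp _ _ _ _ _ hC) Ux hext (- L) (inflap_minus_opp _ _ _ _ hL); lra.
Qed.

Lemma lsc_on_opp n (U : vset n) u : lsc_on U u <-> usc_on U (fun x => - u x).
Proof.
by split=> h x Ux eps e0; have [d [d0 hd]] := h x Ux eps e0; exists d; split=> // y Uy hy;
  have := hd y Uy hy; lra.
Qed.

Lemma visc_super_opp n (U : vset n) u1 u2 :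
  visc_super U u1 u2 <-> visc_sub U (fun x => - u1 x) (fun x => - u2 x).
Proof. by rewrite /visc_super /visc_sub !lsc_on_opp !super_test_opp. Qed.

(** The family of generalized cones is stable under negation: all four parameters change sign. *)
Lemma cone_cmp_below_opp n (U : vset n) u1 u2 :
  cone_cmp_below U u1 u2 <-> cone_cmp_above U (fun x => - u1 x) (fun x => - u2 x).
Proof.
have e1 x0 C1 C2 a b (y : vec n) : psi1 x0 (- C1) (- C2) (- a) (- b) y = - psi1 x0 C1 C2 a b y.
  by rewrite /psi1; ring.
have e2 x0 C1 C2 a b (y : vec n) : psi2 x0 (- C1) (- C2) (- a) (- b) y = - psi2 x0 C1 C2 a b y.
  by rewrite /psi2; ring.
split=> hc x0 r C1 C2 a b Ux0 r0 hU hb x hx;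
  have := hc x0 r (- C1) (- C2) (- a) (- b) Ux0 r0 hU; move=> {}hc.
  have [|h1 h2] := hc _ x hx; last by rewrite e1 e2 in h1 h2; lra.
  by move=> y /hb; rewrite e1 e2; lra.
have [|h1 h2] := hc _ x hx; last by rewrite e1 e2 in h1 h2; lra.
by move=> y /hb; rewrite e1 e2; lra.
Qed.

Lemma cont_on_opp n (U : vset n) u : cont_on U u -> cont_on U (fun x => - u x).
Proof.
move=> h x Ux eps e0; have [d [d0 hd]] := h x Ux eps e0; exists d; split=> // y Uy hy.
by rewrite (_ : _ - _ = - (u y - u x)); [rewrite Rabs_Ropp; exact: hd|ring].
Qed.

Theorem mainTheorem6 (n : nat) (U : vset n) (u1 u2 : vec n -> R) :
  (0 < n)%N -> vdomain U -> vbounded U -> smooth_boundary U ->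
  cont_on (vclosure U) u1 -> cont_on (vclosure U) u2 ->
  (visc_sub U u1 u2 <-> cone_cmp_above U u1 u2) /\
  (visc_super U u1 u2 <-> cone_cmp_below U u1 u2).
Proof.
move=> _ [oU _] _ _ /cont_on_of_closure c1 /cont_on_of_closure c2; split.
  exact: visc_sub_iff_cone_cmp_above.
rewrite visc_super_opp cone_cmp_below_opp.
by apply: visc_sub_iff_cone_cmp_above => //; exact: cont_on_opp.
Qed.
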